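(* Let $m\geq 3$ be an integer and let $\mathcal A$ be a supersolvable arrangement of lines in the real projective plane $\mathbb P^2_{\mathbb R}$ with $m(\mathcal A)=m$ and $\lvert\mathcal A\rvert=2m$. Then $\lvert Sing_2(\mathcal A)\rvert=m$ if and only if $\mathcal A$ and $\mathcal A_{2m}$ are combinatorially equivalent, i.e. have isomorphic Orlik–Solomon algebras.
   Context: A line arrangement $\mathcal A$ in $\mathbb P^2$ over a field is a finite set of distinct lines. $Sing(\mathcal A)$ is the set of points lying on at least two lines of $\mathcal A$; the multiplicity $m_Q$ of $Q\in Sing(\mathcal A)$ is the number of lines of $\mathcal A$ through $Q$, and $m(\mathcal A)=\max\{m_Q: Q\in Sing(\mathcal A)\}$. $Sing_2(\mathcal A)$ is the set of points of $Sing(\mathcal A)$ of multiplicity exactly $2$. A point $P\in Sing(\mathcal A)$ is modular if for every other $Q\in Sing(\mathcal A)$ the line through $P$ and $Q$ belongs to $\mathcal A$; $\mathcal A$ is supersolvable if it has a modular point. The Böröczky arrangement $\mathcal A_{2m}$ is the real arrangement of the $2m$ lines $L_j=V\big(\cos\frac{2\pi j}{m}x+\sin\frac{2\pi j}{m}y+z\big)$ and $L'_k=V\big(\sin\frac{\pi k}{m}x-\cos\frac{\pi k}{m}y\big)$ for $j,k=0,\dots,m-1$ (the lines dual to the points $[\cos\frac{2\pi j}{m},\sin\frac{2\pi j}{m},1]$ and $[-\sin\frac{\pi k}{m},\cos\frac{\pi k}{m},0]$). *)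

(* Defs.v *)
From HB Require Import structures.
From mathcomp Require Import all_boot all_order all_algebra all_field.
From mathcomp Require Import finmap ring.

Set Implicit Arguments.
Unset Strict Implicit.
Unset Printing Implicit Defensive.
Import Order.TTheory GRing.Theory Num.Theory.

Local Open Scope ring_scope.

Section ExteriorAlgebra.
Variables (K : fieldType) (I : finType).

(* The exterior algebra of the free module with basis (e_i), i in I. An element
   x is the family of its coordinates x S on the basis (e_S), S a subset of I,
   where e_S is the product of the e_i, i in S, in increasing order for
   enum_rank. *)
Definition ext : Type := {ffun {set I} -> K^o}.

HB.instance Definition _ := Vector.copy ext {ffun {set I} -> K^o}.

Definition ext_base (S : {set I}) : ext := [ffun T : {set I} => (T == S)%:R].

Definition inversions (S T : {set I}) : nat :=
  \sum_(i in S) \sum_(j in T) (enum_rank j < enum_rank i)%N.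

Definition ext_mul (x y : ext) : ext :=
  [ffun U : {set I} => \sum_(S : {set I} | S \subset U)
               (-1) ^+ inversions S (U :\: S) * (x S * y (U :\: S))].

Definition ext_one : ext := ext_base set0.

Lemma inversionsUl (S T U : {set I}) : [disjoint S & T] ->
  inversions (S :|: T) U = (inversions S U + inversions T U)%N.
Proof.
move=> dST; rewrite /inversions.
by rewrite (eq_bigl _ _ (fun k => in_setU k _ _)) bigU. Qed.

Lemma inversionsUr (S T U : {set I}) : [disjoint T & U] ->
  inversions S (T :|: U) = (inversions S T + inversions S U)%N.
Proof.
move=> dTU; rewrite /inversions -big_split /=; apply: eq_bigr => i _.
by rewrite (eq_bigl _ _ (fun k => in_setU k _ _)) bigU.
Qed.

Lemma inversions0l S : inversions set0 S = 0%N.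
Proof. by rewrite /inversions big_set0. Qed.

Lemma inversions0r S : inversions S set0 = 0%N.
Proof. by rewrite /inversions big1 // => i _; rewrite big_set0. Qed.

Lemma ext_mulA : associative ext_mul.
Proof.
move=> x y z; apply/ffunP => U; rewrite !ffunE.
under eq_bigr => S _ do rewrite ffunE mulrA mulr_sumr.
under [RHS]eq_bigr => S _ do rewrite ffunE mulr_suml mulr_sumr.
rewrite [RHS](exchange_big_dep (fun S : {set I} => S \subset U)) /=; last first.
  by move=> S T SU TS; apply: subset_trans SU.
apply: eq_bigr => S SU.
rewrite [RHS](reindex_onto (fun T : {set I} => S :|: T)
                           (fun T : {set I} => T :\: S)) /=; last first.
  by move=> T /andP[_ ST]; rewrite setDE setUIr setUCr setIT; apply/setUidPr.
apply: eq_big => [T|T TUS].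
  rewrite subUset SU subsetUl /= andbT subsetD setDUl setDv set0U.
  by rewrite (sameP eqP setDidPl).
have TU : T \subset U by apply: subset_trans TUS (subsetDl _ _).
have dTS : [disjoint T & S] by move: TUS; rewrite subsetD => /andP[].
have dST : [disjoint S & T] by rewrite disjoint_sym.
rewrite setDUl setDv set0U (setDidPl dTS).
have -> : U :\: (S :|: T) = (U :\: S) :\: T by rewrite setDDl.
have -> : inversions S (U :\: S) =
    (inversions S T + inversions S ((U :\: S) :\: T))%N.
  rewrite -inversionsUr; last first.
    by rewrite -setI_eq0 setIDA setDIl setDv set0I.
  by congr inversions; rewrite -[LHS](setID _ T) (setIidPr TUS).
rewrite inversionsUl // !exprD !mulrA; congr (_ * _).
by ring.
Qed.

Lemma ext_mul1 : left_id ext_one ext_mul.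
Proof.
move=> x; apply/ffunP => U; rewrite ffunE (bigD1 set0) ?sub0set //= big1.
  by rewrite !ffunE eqxx setD0 inversions0l expr0 !mul1r addr0.
by move=> S /andP[_ /negPf S0]; rewrite ffunE S0 mul0r mulr0.
Qed.

Lemma ext_1mul : right_id ext_one ext_mul.
Proof.
move=> x; apply/ffunP => U; rewrite ffunE (bigD1 U) //= big1.
  by rewrite !ffunE setDv eqxx inversions0r expr0 mul1r mulr1 addr0.
move=> S /andP[SU SneU]; rewrite [ext_one _]ffunE.
case: eqP => [/eqP|]; last by rewrite !mulr0.
by rewrite setD_eq0 => US; rewrite eqEsubset SU US in SneU.
Qed.

Lemma ext_mulDl : left_distributive ext_mul +%R.
Proof.
move=> x y z; apply/ffunP => U; rewrite !ffunE -big_split /=.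
by apply: eq_bigr => S _; rewrite ffunE mulrDl mulrDr.
Qed.

Lemma ext_mulDr : right_distributive ext_mul +%R.
Proof.
move=> x y z; apply/ffunP => U; rewrite !ffunE -big_split /=.
by apply: eq_bigr => S _; rewrite ffunE !mulrDr.
Qed.

Lemma ext_one_neq0 : ext_one != 0.
Proof.
by apply/eqP => /ffunP /(_ set0) /eqP; rewrite !ffunE eqxx oner_eq0.
Qed.

HB.instance Definition _ := GRing.Zmodule_isNzRing.Build ext
  ext_mulA ext_mul1 ext_1mul ext_mulDl ext_mulDr ext_one_neq0.

Lemma ext_scaleAl (a : K) (x y : ext) : a *: (x * y) = (a *: x) * y.
Proof.
apply/ffunP => U; rewrite !ffunE scaler_sumr.
by apply: eq_bigr => S _; rewrite ffunE /GRing.scale /=; ring.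
Qed.

HB.instance Definition _ := GRing.Lmodule_isLalgebra.Build K ext ext_scaleAl.

Lemma ext_scaleAr (a : K) (x y : ext) : a *: (x * y) = x * (a *: y).
Proof.
apply/ffunP => U; rewrite !ffunE scaler_sumr.
by apply: eq_bigr => S _; rewrite ffunE /GRing.scale /=; ring.
Qed.

HB.instance Definition _ := GRing.Lalgebra_isAlgebra.Build K ext ext_scaleAr.
HB.instance Definition _ := Algebra_isFalgebra.Build K ext.

Definition ext_homog (k : nat) (x : ext) : Prop :=
  forall S : {set I}, #|S| != k -> x S = 0.

(* The sum of (-1)^(k-1) e_(S minus i_k) over S = {i_1 < ... < i_p}:
   inversions [set i] S is the number of elements of S preceding i. *)
Definition ext_bd (S : {set I}) : ext :=
  \sum_(i in S) (-1) ^+ inversions [set i] S *: ext_base (S :\ i).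

End ExteriorAlgebra.

Section ProjectivePlane.
Variable F : fieldType.

Definition ppoint : Type := {U : {vspace 'rV[F]_3} | \dim U == 1%N}.
Definition pline : Type := {U : {vspace 'rV[F]_3} | \dim U == 2%N}.

HB.instance Definition _ := Choice.on ppoint.
HB.instance Definition _ := Choice.on pline.

Definition lies_on (P : ppoint) (L : pline) : bool := (val P <= val L)%VS.

Definition zeros (a : 'rV[F]_3) : {vspace 'rV[F]_3} :=
  lker (linfun (mulmxr a^T : 'rV[F]_3 -> 'M[F]_1)).

Lemma dim_zeros (a : 'rV[F]_3) : a != 0 -> \dim (zeros a) == 2%N.
Proof.
move=> a0; rewrite /zeros; set f := linfun _.
have := limg_ker_dim f fullv; rewrite capfv dimvf /= /dim /= => /eqP.
suff -> : \dim (f @: fullv)%VS = 1%N by rewrite addn1 eqSS.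
apply/eqP; rewrite eqn_leq; apply/andP; split.
  by rewrite (leq_trans (dimvS (subvf _))) // dimvf.
rewrite lt0n dimv_eq0; apply: contraNneq a0 => f0.
apply/eqP/rowP => j; rewrite mxE.
have : f (delta_mx 0 j) \in (f @: fullv)%VS by rewrite memv_img ?memvf.
rewrite f0 memv0 lfunE /= -rowE => /eqP /matrixP /(_ 0 0).
by rewrite !mxE.
Qed.

(* The line of equation a_0 x + a_1 y + a_2 z = 0. *)
Definition line_of (a : 'rV[F]_3) (a0 : a != 0) : pline :=
  exist _ (zeros a) (dim_zeros a0).

End ProjectivePlane.

Section OrlikSolomon.
Variables (K F : fieldType) (A : {fset pline F}).

(* The lines of A are the planes of a central arrangement in F^3; its
   Orlik-Solomon algebra, with coefficients in K, is the quotient of the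
   exterior algebra on A by the ideal generated by the elements bd(e_S),
   S dependent, i.e. such that the codimension of the intersection of the
   planes in S is less than #|S|. *)
Definition os_dependent (S : {set A}) : bool :=
  (3 - \dim (\bigcap_(L in S) val (val L)) < #|S|)%N.

Definition os_ideal : {vspace ext K A} :=
  (\sum_(S : {set A} | os_dependent S)
      ({:ext K A} * <[ext_bd K S]> * {:ext K A}))%VS.

Lemma os_ideal_mull x y : y \in os_ideal -> x * y \in os_ideal.
Proof.
move=> yI; have : x * y \in ({:ext K A} * os_ideal)%VS.
  by rewrite memv_mul ?memvf.
apply: subvP; rewrite /os_ideal big_distrr /=.
apply/subv_sumP => S dS; rewrite (subv_trans _ (sumv_sup S _ (subvv _))) //.
by rewrite !prodvA prodvSl // prodvSl // subvf.
Qed.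

Lemma os_ideal_mulr x y : x \in os_ideal -> x * y \in os_ideal.
Proof.
move=> xI; have : x * y \in (os_ideal * {:ext K A})%VS.
  by rewrite memv_mul ?memvf.
apply: subvP; rewrite /os_ideal big_distrl /=.
apply/subv_sumP => S dS; rewrite (subv_trans _ (sumv_sup S _ (subvv _))) //.
by rewrite -!prodvA prodvSr // prodvSr // subvf.
Qed.

Lemma ext_mul0E (x y : ext K A) : (x * y) set0 = x set0 * y set0.
Proof.
rewrite ffunE (bigD1 set0) ?sub0set //= big1 ?addr0.
  by rewrite setD0 inversions0l mul1r.
by move=> S; rewrite subset0 => /andP[->].
Qed.

Lemma os_bd0E (S : {set A}) : os_dependent S -> ext_bd K S set0 = 0.
Proof.
move=> dS; rewrite /ext_bd sum_ffunE big1 // => i iS; rewrite !ffunE.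
case: eqP => [/esym/eqP|_]; last by rewrite scaler0.
rewrite setD_eq0 => Si; have SE : S = [set i].
  by apply/eqP; rewrite eqEsubset Si sub1set.
by move: dS; rewrite /os_dependent SE big_set1 cards1 (eqP (valP (val i))).
Qed.

Let coef0 (x : ext K A) : K^o := x set0.

Let coef0_linear : linear coef0.
Proof. by move=> a x y; rewrite /coef0 !ffunE. Qed.

HB.instance Definition _ := GRing.isLinear.Build K (ext K A) K^o _ coef0
  coef0_linear.

Lemma os_ideal_proper : 1 \notin os_ideal.
Proof.
have idealZ : (os_ideal <= lker (linfun coef0))%VS.
  apply/subv_sumP => S dS; apply/prodvP => x y xS _.
  have : x \in lker (linfun coef0).
    move: xS; apply: subvP; apply/prodvP => u _ _ /vlineP[c ->].
    rewrite memv_ker lfunE /= /coef0 ext_mul0E ffunE os_bd0E //.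
    by rewrite scaler0 mulr0.
  by rewrite !memv_ker !lfunE /= /coef0 ext_mul0E => /eqP ->; rewrite mul0r.
apply: contraL (isT) => /(subvP idealZ).
by rewrite memv_ker lfunE /= /coef0 ffunE eqxx oner_eq0.
Qed.

Local Open Scope quotient_scope.

Definition os : Type := {ideal_quot os_ideal}.

HB.instance Definition _ := Choice.on os.
HB.instance Definition _ := GRing.Zmodule.on os.
HB.instance Definition _ := EqQuotient.on os.

Definition os_pi (x : ext K A) : os := \pi_os x.
Let os_repr (u : os) : ext K A := repr u.

Let os_reprK u : os_pi (os_repr u) = u. Proof. exact: reprK. Qed.

Lemma os_pi_eq x y : (os_pi x == os_pi y) = (x - y \in os_ideal).
Proof. by rewrite -Quotient.equivE /os_pi piE. Qed.

Lemma os_piD x y : os_pi (x + y) = os_pi x + os_pi y.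
Proof. exact: Quotient.pi_add. Qed.

Definition os_mul (u v : os) : os := os_pi (os_repr u * os_repr v).
Definition os_scale (a : K) (u : os) : os := os_pi (a *: os_repr u).

Let repr_pi x : os_repr (os_pi x) - x \in os_ideal.
Proof. by rewrite -os_pi_eq os_reprK. Qed.

Lemma os_piM x y : os_pi (x * y) = os_mul (os_pi x) (os_pi y).
Proof.
apply/esym/eqP; rewrite os_pi_eq -(subrKA (os_repr (os_pi x) * y)).
rewrite -mulrBr -mulrBl memvD //.
  exact: os_ideal_mull.
exact: os_ideal_mulr.
Qed.

Lemma os_piZ a x : os_pi (a *: x) = os_scale a (os_pi x).
Proof. by apply/esym/eqP; rewrite os_pi_eq -scalerBr memvZ // repr_pi. Qed.

Let os_mulA : associative os_mul.
Proof.
move=> u v w; rewrite -(os_reprK u) -(os_reprK v) -(os_reprK w).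
by rewrite -!os_piM mulrA.
Qed.

Let os_1mul : left_id (os_pi 1) os_mul.
Proof. by move=> u; rewrite -(os_reprK u) -os_piM mul1r. Qed.

Let os_mul1 : right_id (os_pi 1) os_mul.
Proof. by move=> u; rewrite -(os_reprK u) -os_piM mulr1. Qed.

Let os_mulDl : left_distributive os_mul +%R.
Proof.
move=> u v w; rewrite -(os_reprK u) -(os_reprK v) -(os_reprK w).
by rewrite -os_piD -!os_piM -os_piD mulrDl.
Qed.

Let os_mulDr : right_distributive os_mul +%R.
Proof.
move=> u v w; rewrite -(os_reprK u) -(os_reprK v) -(os_reprK w).
by rewrite -os_piD -!os_piM -os_piD mulrDr.
Qed.

Let os_one_neq0 : os_pi 1 != 0.
Proof.
have <- : os_pi 0 = 0 by apply: (addrI (os_pi 0)); rewrite -os_piD !addr0.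
by rewrite os_pi_eq subr0 os_ideal_proper.
Qed.

HB.instance Definition _ := GRing.Zmodule_isNzRing.Build os
  os_mulA os_1mul os_mul1 os_mulDl os_mulDr os_one_neq0.

Let os_scaleA a b u : os_scale a (os_scale b u) = os_scale (a * b) u.
Proof. by rewrite -(os_reprK u) -!os_piZ scalerA. Qed.

Let os_scale1 : left_id 1 os_scale.
Proof. by move=> u; rewrite -(os_reprK u) -os_piZ scale1r. Qed.

Let os_scaleDr : right_distributive os_scale +%R.
Proof.
move=> a u v; rewrite -(os_reprK u) -(os_reprK v).
by rewrite -os_piD -!os_piZ -os_piD scalerDr.
Qed.

Let os_scaleDl u : {morph os_scale^~ u : a b / a + b}.
Proof.
by move=> a b; rewrite /= -(os_reprK u) -!os_piZ -os_piD scalerDl.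
Qed.

HB.instance Definition _ := GRing.Zmodule_isLmodule.Build K os
  os_scaleA os_scale1 os_scaleDr os_scaleDl.

Let os_mulE (u v : os) : u * v = os_mul u v. Proof. by []. Qed.
Let os_scaleE (a : K) (u : os) : a *: u = os_scale a u. Proof. by []. Qed.

Let os_scaleAl (a : K) (u v : os) : a *: (u * v) = (a *: u) * v.
Proof.
rewrite -(os_reprK u) -(os_reprK v) !os_mulE !os_scaleE.
by rewrite -os_piM -2!os_piZ -os_piM scalerAl.
Qed.

HB.instance Definition _ := GRing.Lmodule_isLalgebra.Build K os os_scaleAl.

Let os_scaleAr (a : K) (u v : os) : a *: (u * v) = u * (a *: v).
Proof.
rewrite -(os_reprK u) -(os_reprK v) !os_mulE !os_scaleE.
by rewrite -os_piM -2!os_piZ -os_piM scalerAr.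
Qed.

HB.instance Definition _ := GRing.Lalgebra_isAlgebra.Build K os os_scaleAr.

Definition os_homog (k : nat) (u : os) : Prop :=
  exists2 x : ext K A, ext_homog k x & u = os_pi x.

End OrlikSolomon.

(* Isomorphism of graded K-algebras; since f is bijective and the gradings are
   finite, f then maps each graded piece onto the corresponding one. *)
Definition combinatorially_equivalent (K F : fieldType) (A B : {fset pline F}) :
    Prop :=
  exists2 f : {lrmorphism os K A -> os K B},
    bijective f & forall k u, os_homog k u -> os_homog k (f u).

From mathcomp Require Import all_classical all_reals all_analysis.

Section LineArrangement.
Variable F : fieldType.
Implicit Types (A : {fset pline F}) (P Q : ppoint F).

Local Open Scope classical_set_scope.

Definition multiplicity A P : nat := #|` [fset L in A | lies_on P L]%fset|.

Definition Sing A : set (ppoint F) := [set P | (2 <= multiplicity A P)%N].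

Definition Sing2 A : set (ppoint F) :=
  [set P | Sing A P /\ multiplicity A P = 2%N].

(* fset_set is meaningful only on finite sets. *)
Lemma finite_Sing A : finite_set (Sing A).
Proof.
pose meet (p : pline F * pline F) := (val p.1 :&: val p.2)%VS.
have finB : finite_set (meet @` ([set` A] `*` [set` A])).
  by apply: finite_image; apply: finite_setX; apply: finite_fset.
apply: (@sub_finite_set _ _ (val @^-1` (meet @` ([set` A] `*` [set` A])))).
  move=> P; rewrite /Sing /multiplicity /=.
  rewrite cardfE => /card_gt1P[[L1 L1B] [[L2 L2B] [_ _]]].
  rewrite -val_eqE /= => L12.
  move: L1B L2B; rewrite !inE /= => /andP[L1A P1] /andP[L2A P2].
  exists (L1, L2) => //; rewrite /meet /=; apply/esym/eqP.
  rewrite eqEdim subv_cap; apply/andP; split; first exact/andP.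
  rewrite (eqP (valP P)) leqNgt; apply: contra L12 => d2.
  have sub (U V : pline F) : (2 <= \dim (val U :&: val V))%N ->
      (val U :&: val V)%VS = val U.
    by move=> dUV; apply/eqP; rewrite eqEdim capvSl (eqP (valP U)).
  by rewrite -val_eqE -[X in X == _](sub L1 L2) // capvC (sub L2 L1) // capvC.
by apply: finite_preimage => // P Q _ _; apply: val_inj.
Qed.

Definition max_multiplicity A : nat :=
  \max_(P <- fset_set (Sing A)) multiplicity A P.

Definition modular A P : Prop :=
  Sing A P /\
  forall Q, Sing A Q -> Q <> P ->
    exists2 L : pline F, L \in A & val L = (val P + val Q)%VS.

Definition supersolvable A : Prop := exists P, modular A P.

End LineArrangement.

Section Boroczky.
Variable R : realType.

Definition row3 (a b c : R) : 'rV[R]_3 := \row_(i < 3) [:: a; b; c]`_i.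

Lemma boroczky1_neq0 (m j : nat) :
  row3 (cos (2 * pi * j%:R / m%:R)) (sin (2 * pi * j%:R / m%:R)) 1 != 0.
Proof.
by apply/eqP => /rowP /(_ ord_max) /eqP; rewrite !mxE /= oner_eq0.
Qed.

Lemma boroczky2_neq0 (m k : nat) :
  row3 (sin (pi * k%:R / m%:R)) (- cos (pi * k%:R / m%:R)) 0 != 0.
Proof.
apply/eqP => /rowP row0; move: (row0 ord0) (row0 (inord 1)).
rewrite !mxE inordK //= => s0 /eqP; rewrite oppr_eq0 => /eqP c0.
have /eqP := cos2Dsin2 (pi * k%:R / m%:R : R).
by rewrite s0 c0 expr0n /= addr0 eq_sym oner_eq0.
Qed.

Definition boroczkyL (m j : nat) : pline R := line_of (boroczky1_neq0 m j).
Definition boroczkyL' (m k : nat) : pline R := line_of (boroczky2_neq0 m k).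

Definition boroczky (m : nat) : {fset pline R} :=
  ([fset boroczkyL m j | j in iota 0 m]
   `|` [fset boroczkyL' m k | k in iota 0 m])%fset.

End Boroczky.

(* Main.v *)
Require Import Defs.
From HB Require Import structures.
From mathcomp Require Import all_boot all_order all_algebra all_field.
From mathcomp Require Import finmap zify ring lra.
From mathcomp Require Import all_classical all_reals all_analysis.
From mathcomp Require Import fintype finset.

(* Let P be the modular point; it has multiplicity m, since a line missing both P
   and a point Q of larger multiplicity would embed the pencil at Q into that at P.
   Call L_i the m lines through P and M_j the other m lines.  Each M_j meets the
   other M_k on lines L_i, and it carries one double point if no three of the M's
   meet on it, more otherwise; so there are m double points if and only if no three
   lines M_j are concurrent.

   If no three are, draw P as the vertical point at infinity.  Sweeping a vertical
   line across the L_i, the order of the M_j is reversed in m steps by swaps of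
   neighbours; every M_j stays put in exactly one step, which forces it to bounce
   between the extreme positions like a billiard ball.  Hence, after renumbering,
   M_i and M_j meet on L_(i+j), indices modulo m, as in the Boroczky arrangement,
   and relabelling the generators is an isomorphism of Orlik-Solomon algebras.

   Conversely, the combinations with coefficient sum zero of the lines through a
   point of multiplicity at least 4 contain a three-dimensional space of degree one
   elements with pairwise zero products.  In the algebra of the Boroczky arrangement
   every such space lies in the pencil of the L_i, because in characteristic 0 the
   coefficients at the M_j cannot be affine along a progression modulo m.  So an
   arrangement with an isomorphic algebra has only one point of multiplicity at
   least 4 (three concurrent M's and the L_i through their common point would give a
   second one). *)

Set Implicit Arguments.
Unset Strict Implicit.
Unset Printing Implicit Defensive.
Import Order.TTheory GRing.Theory Num.Theory.

Local Open Scope ring_scope.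

(** * Allowable sequences *)

Section AllowableSequence.
Variables (m : nat) (d : 'I_m -> 'I_m -> 'I_m).
Hypothesis dC : forall p q, d p q = d q p.
(** No three lines are concurrent, so the crossings of one step are disjoint swaps. *)
Hypothesis dI : forall p q r, q != p -> r != p -> d p q = d p r -> q = r.

(* Line q lies below line p after k crossing steps: the lines are numbered by
   increasing slope and d p q is the step at which p and q cross. *)
Definition below (k : nat) (q p : 'I_m) : bool :=
  (q != p) && ((p < q)%N (+) (d p q < k)%N).

(** [below k] is total and irreflexive by construction; transitivity says that each stage is a
    linear order of the lines. *)
Hypothesis below_trans : forall k p q r,
  below k p q -> below k q r -> below k p r.

Let below_total k p q : p != q -> below k p q = ~~ below k q p.
Proof.
move=> pq; rewrite /below pq eq_sym pq /= dC -addNb; congr (_ (+) _).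
by move: pq; rewrite -val_eqE /=; lia.
Qed.

Let below_irr k p : below k p p = false.
Proof. by rewrite /below eqxx. Qed.

Let belowS k p q : d p q != k :> nat -> below k.+1 q p = below k q p.
Proof. by move=> h; rewrite /below ltnS [(d p q <= k)%N]leq_eqVlt (negPf h). Qed.

Let below_neq k p q : below k p q -> p != q.
Proof. by case/andP. Qed.

Let below_swap k p q : d p q = k :> nat -> below k p q -> below k.+1 q p.
Proof.
move=> dk; rewrite /below dC dk ltnn ltnSn addbF addbT => /andP[h h2].
by rewrite eq_sym h -leqNgt ltnW.
Qed.

Let d_neq k p q r : p != q -> p != r -> q != r -> d p q = k :> nat ->
  d p r != k :> nat.
Proof.
move=> pq pr qr dk; apply: contraNneq qr => dk'; apply/eqP.
by apply: (@dI p); rewrite 1?eq_sym //; apply: val_inj; rewrite /= dk dk'.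
Qed.

(** Lines about to swap are neighbours: a line [r] between them crosses neither at this step, so it
    would still separate them, in the old order, after the swap. [adjS] is the same statement just
    after the swap. *)
Let adj k p q r : d p q = k :> nat -> below k p q -> below k p r ->
  below k r q -> False.
Proof.
move=> dk pq pr rq.
have h1 : below k.+1 p r.
  rewrite belowS // dC; apply: d_neq dk; rewrite ?(below_neq pr) //.
    exact: below_neq pq.
  by rewrite eq_sym (below_neq rq).
have h2 : below k.+1 r q.
  rewrite belowS //; apply: (@d_neq _ _ p).
  - by rewrite eq_sym (below_neq pq).
  - by rewrite eq_sym (below_neq rq).
  - exact: below_neq pr.
  - by rewrite dC.
have := below_trans h1 h2; rewrite below_total ?(below_neq pq) //.
by rewrite (below_swap dk pq).
Qed.

Let adjS k p q r : d p q = k :> nat -> below k.+1 p q -> below k.+1 p r ->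
  below k.+1 r q -> False.
Proof.
move=> dk pq pr rq.
have h1 : below k p r.
  rewrite -belowS // dC; apply: d_neq dk; rewrite ?(below_neq pr) //.
    exact: below_neq pq.
  by rewrite eq_sym (below_neq rq).
have h2 : below k r q.
  rewrite -belowS //; apply: (@d_neq _ _ p).
  - by rewrite eq_sym (below_neq pq).
  - by rewrite eq_sym (below_neq rq).
  - exact: below_neq pr.
  - by rewrite dC.
have h3 := below_trans h1 h2.
by have := below_swap dk h3; rewrite below_total 1?eq_sym ?(below_neq pq) // pq.
Qed.

(** The height of [p] after [k] steps, counted from 0 at the bottom. *)
Let N k p := #|[set q | below k q p]|.

Let N_stay k p : (forall q, q != p -> d p q != k :> nat) -> N k.+1 p = N k p.
Proof.
move=> h; apply: eq_card => q; rewrite !inE.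
have [->|qp] := eqVneq q p; first by rewrite !below_irr.
by rewrite belowS // h.
Qed.

Let N_adj k p q : d p q = k :> nat -> below k p q ->
  [set r | below k r q] = p |: [set r | below k r p].
Proof.
move=> dk pq; apply/setP => r; rewrite !inE.
have [->|rp] := eqVneq r p; first by rewrite pq.
apply/idP/idP => /= h; last exact: below_trans h pq.
rewrite below_total //; apply/negP => pr; exact: adj dk pq pr h.
Qed.

Let N_adjS k p q : d p q = k :> nat -> below k p q -> N k q = (N k p).+1.
Proof. by move=> dk pq; rewrite /N (N_adj dk pq) cardsU1 inE below_irr. Qed.

Let N_up k p q : d p q = k :> nat -> below k p q -> N k.+1 p = (N k p).+1.
Proof.
move=> dk pq; have qp := below_swap dk pq.
have -> : (N k p).+1 = #|q |: [set r | below k r p]|.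
  rewrite cardsU1 inE below_total ?pq //.
  by rewrite eq_sym (below_neq pq).
apply: eq_card => r; rewrite !inE.
have [->|rq] := eqVneq r q; first by rewrite qp.
have [->|rp] := eqVneq r p; first by rewrite !below_irr.
rewrite belowS //; apply: d_neq dk; rewrite 1?eq_sym //.
by rewrite eq_sym (below_neq pq).
Qed.

Let N_down k p q : d p q = k :> nat -> below k p q -> N k.+1 q = N k p.
Proof.
move=> dk pq; have qp := below_swap dk pq.
apply: eq_card => r; rewrite !inE.
have [->|rp] := eqVneq r p.
  by rewrite below_irr below_total ?(below_neq pq) // qp.
have [->|rq] := eqVneq r q.
  by rewrite below_irr below_total ?pq // eq_sym (below_neq pq).
have -> : below k.+1 r q = below k r q.
  rewrite belowS //; apply: (@d_neq _ _ p); rewrite 1?eq_sym ?(below_neq pq) //.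
  by rewrite dC.
by have /setP/(_ r) := N_adj dk pq; rewrite !inE (negPf rp).
Qed.

Let card_lt (p : 'I_m) : #|[set q : 'I_m | (q < p)%N]| = p.
Proof.
rewrite cardsE -sum1_card (big_ord_narrow (ltnW (ltn_ord p))).
by rewrite sum1_card card_ord.
Qed.

(** After all crossings the heights are the ranks of the slopes; [N_first] records that they start
    in the reverse order. *)
Let N_last p : N m p = p.
Proof.
rewrite -[RHS]card_lt; apply: eq_card => q.
rewrite !inE /below ltn_ord addbT -leqNgt ltn_neqAle.
by rewrite (inj_eq val_inj).
Qed.

Let N_first p : (N 0 p + p).+1 = m.
Proof.
rewrite -[X in (_ + X).+1]card_lt -[RHS]card_ord.
rewrite -[#|'I_m|](cardsC [set q : 'I_m | (q < p)%N]) addnC -addnS; congr addn.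
have -> : ~: [set q : 'I_m | (q < p)%N] = p |: [set q | below 0 q p].
  apply/setP => q; rewrite !inE /below addbF -leqNgt leq_eqVlt.
  rewrite [val p == _](inj_eq val_inj) eq_sym.
  by case: (eqVneq q p).
by rewrite cardsU1 inE below_irr.
Qed.

(** A line rises when it crosses one of smaller slope and falls when it crosses one of larger
    slope. *)
Let up p k := [exists q, [&& q != p, d p q == k :> nat & (q < p)%N]].
Let down p k := [exists q, [&& q != p, d p q == k :> nat & (p < q)%N]].

Let upP p k : up p k -> exists2 q, d p q = k :> nat & below k p q.
Proof.
case/existsP => q /and3P[qp /eqP dk lt]; exists q => //.
by rewrite /below eq_sym qp dC dk ltnn addbF.
Qed.

Let downP p k : down p k -> exists2 q, d p q = k :> nat & below k q p.
Proof.
case/existsP => q /and3P[qp /eqP dk lt]; exists q => //.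
by rewrite /below qp dk ltnn addbF.
Qed.

Let NupE p k : up p k -> N k.+1 p = (N k p).+1.
Proof. by case/upP => q dk pq; apply: N_up pq. Qed.

Let NdownE p k : down p k -> N k p = (N k.+1 p).+1.
Proof.
case/downP => q; rewrite dC => dk qp.
by rewrite (N_adjS dk qp) (N_down dk qp).
Qed.

(** The line just passed and the line about to be crossed would both be the lower neighbour of [p],
    yet they differ because they cross [p] at different steps. *)
Let no_up_down p k : up p k -> down p k.+1 -> False.
Proof.
case/upP => q dq /(below_swap dq) qp /downP[r dr rp].
have qr : q != r by apply/eqP => e; move: dr; rewrite -e dq => /n_Sn.
have [h|h] := boolP (below k.+1 q r).
  by apply: adjS (h) rp => //; rewrite dC.
by apply: (adj _ rp _ qp); rewrite ?dr 1?dC // below_total 1?eq_sym.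
Qed.

Let no_down_up p k : down p k -> up p k.+1 -> False.
Proof.
case/downP => q; rewrite dC => dq /(below_swap dq) pq /upP[r dr pr].
have qr : q != r by apply/eqP => e; move: dr; rewrite -e dC dq => /n_Sn.
have [h|h] := boolP (below k.+1 q r).
  by apply: (adj dr pr pq h).
by apply: adjS pq pr _; rewrite 1?dC // below_total 1?eq_sym.
Qed.

(** The [m - 1] crossings of [p] occur at distinct steps, which leaves exactly one of the [m] steps
    free. *)
Let stay p : exists2 t : 'I_m, forall q, q != p -> d p q != t &
  forall k : 'I_m, k != t -> up p k || down p k.
Proof.
have inj : {in [set~ p] &, injective (d p)}.
  by move=> q r; rewrite !inE => qp rp; apply: dI.
have c1 : #|~: (d p @: [set~ p])| = 1%N.
  have := cardsC (d p @: [set~ p]); rewrite card_in_imset // cardsC1 card_ord.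
  by have := ltn_ord p; lia.
have /cards1P[t tE] := introT eqP c1.
exists t => [q qp|k kt].
  apply/eqP => e; have : t \in ~: (d p @: [set~ p]) by rewrite tE inE.
  by rewrite inE -e imset_f // !inE.
have : k \notin ~: (d p @: [set~ p]) by rewrite tE inE.
rewrite inE negbK => /imsetP[q]; rewrite !inE => qp ->.
have : (q < p)%N || (p < q)%N by rewrite -neq_ltn.
by case/orP => lt; apply/orP; [left|right]; apply/existsP; exists q;
  rewrite qp eqxx lt.
Qed.

(* Consecutive moves of a line have the same direction, so it moves monotonely
   before and after the only step at which it stays. *)
Let phase p (a b : nat) :
  (forall k, (a <= k < b)%N -> up p k || down p k) ->
  (forall k, (a <= k < b)%N -> up p k) \/ (forall k, (a <= k < b)%N -> down p k).
Proof.
move=> h; have [ab|ba] := ltnP a b; last by left => k; lia.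
have [ua|ua] := boolP (up p a); [left|right] => k.
  elim: k => [|k IH] kab; first by have -> : 0%N = a by lia.
  have [e|ne] := eqVneq a k.+1; first by rewrite -e.
  have uk : up p k by apply: IH; lia.
  by case/orP: (h _ kab) => // /(no_up_down uk).
have da : down p a by have := h a; rewrite leqnn ab (negPf ua); apply.
elim: k => [|k IH] kab; first by have -> : 0%N = a by lia.
have [e|ne] := eqVneq a k.+1; first by rewrite -e.
have uk : down p k by apply: IH; lia.
by case/orP: (h _ kab) => // /(no_down_up uk).
Qed.

Let N_ups p a b : (a <= b)%N -> (forall k, (a <= k < b)%N -> up p k) ->
  N b p = (N a p + (b - a))%N.
Proof.
move=> ab; rewrite -{1 2}(subnKC ab); elim: (b - a)%N => [|n IH] h.
  by rewrite !addn0.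
rewrite addnS NupE; last by apply: h; lia.
by rewrite IH ?addnS // => k hk; apply: h; lia.
Qed.

Let N_downs p a b : (a <= b)%N -> (forall k, (a <= k < b)%N -> down p k) ->
  N a p = (N b p + (b - a))%N.
Proof.
move=> ab; rewrite -{1 2}(subnKC ab); elim: (b - a)%N => [|n IH] h.
  by rewrite !addn0.
rewrite IH => [|k hk]; last by apply: h; lia.
by rewrite addnS [N (a + n) p]NdownE ?addnS //; apply: h; lia.
Qed.

(* Both crossings would be with the neighbour in slope. *)
Let not_up_up (p : 'I_m) : (0 < m)%N -> p.+1 = m -> up p 0 -> up p m.-1 -> False.
Proof.
move=> m0 pm /upP[q dq pq] /upP[r dr pr].
have lt1 u : u != p -> (u < p)%N.
  by rewrite -val_eqE /=; have := ltn_ord u; lia.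
have nq : q != p by rewrite eq_sym (below_neq pq).
have nr : r != p by rewrite eq_sym (below_neq pr).
have pr' := below_swap dr pr.
have qr : (q < r)%N || (r < q)%N.
  rewrite -neq_ltn; apply/eqP => /val_inj e; move: dr; rewrite -e dq => m1.
  by have := lt1 _ nq; lia.
case/orP: qr => h.
- apply: (adj (r := r) dq pq); rewrite /below addbF.
    by rewrite eq_sym nr lt1.
  by rewrite h -(inj_eq val_inj) gtn_eqF.
- have dr2 : d r p = m.-1 :> nat by rewrite dC.
  apply: (adjS (r := q) dr2 pr'); rewrite prednK // /below ltn_ord addbT -leqNgt.
    by rewrite -val_eqE /=; lia.
  by rewrite nq ltnW // lt1.
Qed.

(** The mirror image, for the line of smallest slope. *)
Let not_down_down (p : 'I_m) : (1 < m)%N -> p = 0%N :> nat -> down p 0 ->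
  down p m.-1 -> False.
Proof.
move=> m1 p0 /downP[q dq pq] /downP[r dr pr].
have lt1 u : u != p -> (p < u)%N.
  by rewrite -val_eqE /=; lia.
have nq : q != p by rewrite (below_neq pq).
have nr : r != p by rewrite (below_neq pr).
have dr2 : d r p = m.-1 :> nat by rewrite dC.
have dq2 : d q p = 0%N :> nat by rewrite dC.
have pr' := below_swap dr2 pr.
have qr : (q < r)%N || (r < q)%N.
  by rewrite -neq_ltn; apply/eqP => /val_inj e; move: dr; rewrite -e dq; lia.
case/orP: qr => h.
- apply: (adjS (r := q) dr pr'); rewrite prednK ?(ltnW m1) // /below ltn_ord
    addbT -leqNgt.
    by rewrite eq_sym nq ltnW // lt1.
  by rewrite ltnW // -(inj_eq val_inj) ltn_eqF.
- apply: (adj (r := r) dq2 pq); rewrite /below addbF.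
    by rewrite h -(inj_eq val_inj) gtn_eqF.
  by rewrite nr lt1.
Qed.

(* Lines move like billiard balls, staying one step at the end positions, hence
   uniformly on a cycle of length 2m; C p is the phase of p. *)
Let phase_const p : exists C : nat,
  (forall k, (k < m)%N -> up p k ->
     (N k p + C).+1 = k \/ (N k p + C).+1 = (k + m.*2)%N) /\
  (forall k, (k < m)%N -> down p k -> (N k p + k)%N = C).
Proof.
have [t tstay tmove] := stay p.
have tm := ltn_ord t; have pm := ltn_ord p; have F := N_first p; have L := N_last p.
have ph1 := @phase p 0 t; have ph2 := @phase p t.+1 m.
have St : N t.+1 p = N t p by apply: N_stay => q /tstay; rewrite -val_eqE.
have mv k : (k < m)%N -> k != t -> up p k || down p k.
  by move=> km kt; have := tmove (Ordinal km); rewrite -val_eqE; apply.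
have not_both k : up p k -> down p k -> False.
  by move=> /NupE u /NdownE; lia.
have not_t k : up p k || down p k -> k != t.
  case/orP => [/existsP|/existsP] [q /and3P[qp /eqP <- _]]; exact: tstay.
(* First type of path: [p] rises to the top, rests there at step [t = p], then falls; its phase is
   [m + p]. *)
have typeU : (forall k, (0 <= k < t)%N -> up p k) ->
    (forall k, (t.+1 <= k < m)%N -> down p k) -> t = p :> nat ->
    (forall k, (k < m)%N -> up p k ->
     (N k p + (m + p)).+1 = k \/ (N k p + (m + p)).+1 = (k + m.*2)%N) /\
    (forall k, (k < m)%N -> down p k -> (N k p + k)%N = (m + p)%N).
  move=> hu hd tp; split=> k km.
    move=> uk; right.
    have kt : (k < t)%N.
      have : k != t by apply: not_t; rewrite uk.
      case: (ltngtP k t) => // tk _; exfalso; apply: (not_both k) => //.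
      by apply: hd; lia.
    have := @N_ups p 0 k (leq0n _); move=> /(_ _)-> => [|l lk]; first by lia.
    by apply: hu; lia.
  move=> dk.
  have kt : (t < k)%N.
    have : k != t by apply: not_t; rewrite dk orbT.
    case: (ltngtP k t) => // tk _; exfalso; apply: (not_both k) => //.
    by apply: hu; lia.
  have := @N_downs p k m (ltnW km); move=> /(_ _)-> => [|l lk]; first by lia.
  by apply: hd; lia.
(* Second type: [p] falls to the bottom, rests there at step [t = m - 1 - p], then rises; its phase
   is [t]. *)
have typeD : (forall k, (0 <= k < t)%N -> down p k) ->
    (forall k, (t.+1 <= k < m)%N -> up p k) -> (t + p).+1 = m ->
    (forall k, (k < m)%N -> up p k ->
     (N k p + t).+1 = k \/ (N k p + t).+1 = (k + m.*2)%N) /\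
    (forall k, (k < m)%N -> down p k -> (N k p + k)%N = t).
  move=> hd hu tp; split=> k km.
    move=> uk; left.
    have kt : (t < k)%N.
      have : k != t by apply: not_t; rewrite uk.
      case: (ltngtP k t) => // tk _; exfalso; apply: (not_both k) => //.
      by apply: hd; lia.
    have := @N_ups p k m (ltnW km); rewrite L => h.
    have {h} := h (fun l lk => hu l ltac:(lia)); lia.
  move=> dk.
  have kt : (k < t)%N.
    have : k != t by apply: not_t; rewrite dk orbT.
    case: (ltngtP k t) => // tk _; exfalso; apply: (not_both k) => //.
    by apply: hu; lia.
  have := @N_downs p 0 k (leq0n _) => h.
  have {h} := h (fun l lk => hd l ltac:(lia)); lia.
have {}ph1 := ph1 (fun k hk => mv k ltac:(lia) ltac:(lia)).
have {}ph2 := ph2 (fun k hk => mv k ltac:(lia) ltac:(lia)).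
case: ph1 => h1; case: ph2 => h2.
(* Rising on both sides of the rest forces the largest slope. A rest at the first or last step
   leaves one side empty, which gives one of the two types; [not_up_up] excludes the others. *)
- have e1 := N_ups (leq0n _) h1; have e2 := N_ups tm h2.
  have pE : p.+1 = m by lia.
  have [t0|t0] := posnP t.
    by exists t; apply: typeD => //; [move=> k; rewrite t0; lia | lia].
  have [tl|tl] := eqVneq (t : nat) m.-1.
    by exists (m + p)%N; apply: typeU => //; [move=> k; lia | lia].
  by exfalso; apply: (@not_up_up p) => //; [lia|apply: h1; lia|apply: h2; lia].
- have e1 := N_ups (leq0n _) h1; have e2 := N_downs tm h2.
  by exists (m + p)%N; apply: typeU => //; lia.
- have e1 := N_downs (leq0n _) h1; have e2 := N_ups tm h2.
  by exists t; apply: typeD => //; lia.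
- have e1 := N_downs (leq0n _) h1; have e2 := N_downs tm h2.
  have pE : p = 0%N :> nat by lia.
  have [t0|t0] := posnP t.
    by exists (m + p)%N; apply: typeU => //; [move=> k; rewrite t0; lia | lia].
  have [tl|tl] := eqVneq (t : nat) m.-1.
    by exists t; apply: typeD => //; [move=> k; lia | lia].
  by exfalso; apply: (@not_down_down p) => //;
    [lia|apply: h1; lia|apply: h2; lia].
Qed.

(** If [p] rises past [q] at step k, and [q] has height h before the swap, then C q = h + k, while C
    p is k - h modulo 2m; the sum is 2k modulo 2m. *)
Let crossing_sum : exists C : 'I_m -> nat, forall p q : 'I_m, p != q ->
  (C p + C q = (d p q).*2)%N \/ (C p + C q = (d p q).*2 + m.*2)%N.
Proof.
have /fin_all_exists[C CP] := phase_const; exists C.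
suff H (p q : 'I_m) : (q < p)%N ->
  (C p + C q = (d p q).*2)%N \/ (C p + C q = (d p q).*2 + m.*2)%N.
  move=> p q; rewrite -(inj_eq val_inj) neq_ltn => /orP[] h; last exact: H.
  by rewrite addnC dC; apply: H.
move=> qp; have pq : p != q by rewrite -(inj_eq val_inj) gtn_eqF.
have dm := ltn_ord (d p q).
have u : up p (d p q) by apply/existsP; exists q; rewrite eq_sym pq eqxx qp.
have w : down q (d p q) by apply/existsP; exists p; rewrite pq dC eqxx qp.
have [cu _] := CP p; have [_ cd] := CP q.
have b : below (d p q) p q by rewrite /below pq dC ltnn addbF.
have e : N (d p q) q = (N (d p q) p).+1 by apply: N_adjS b.
by have := cu _ dm u; have := cd _ dm w; lia.
Qed.

(** Sums of two phases are even, so all phases share one parity [e]; halving the phases turns the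
    relation modulo 2m into one modulo m. *)
Lemma allowable_labelling : (2 < m)%N -> exists (a : 'I_m -> 'I_m) (e : nat),
  injective a /\ forall p q, p != q -> d p q = ((a p + a q + e) %% m)%N :> nat.
Proof.
move=> m2; have [C CP] := crossing_sum.
have m0 : (0 < m)%N by lia.
pose a p := Ordinal (ltn_pmod (C p)./2 m0); pose z := Ordinal m0.
pose e := nat_of_bool (odd (C z)).
have oddC p : odd (C p) = odd (C z).
  have [->//|pz] := eqVneq p z.
  by have := CP _ _ pz; have := odd_double_half (C p);
    have := odd_double_half (C z); case: (odd (C p)); case: (odd (C z)) => /=;
    lia.
have dE p q : p != q -> d p q = ((a p + a q + e) %% m)%N :> nat.
  move=> pq; rewrite /= -modnDml modnDm modnDml.
  have [h|h] : ((C p)./2 + (C q)./2 + e = d p q \/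
       (C p)./2 + (C q)./2 + e = d p q + m)%N.
  - have := CP _ _ pq; rewrite -(odd_double_half (C p)) -(odd_double_half (C q)).
    rewrite !oddC !half_bit_double /e; lia.
  - by rewrite h modn_small.
  - by rewrite h modnDr modn_small.
exists a, e; split=> // p q apq; apply/eqP/negPn/negP => pq.
(* Two lines with the same label would cross a third line [r] at the same step, against [dI]. *)
have [r /andP[rp rq]] : exists r, (r != p) && (r != q).
  have : (0 < #|~: [set p; q]|)%N.
    by have := cardsC [set p; q]; rewrite cards2 card_ord pq; lia.
  by case/card_gt0P => r; rewrite !inE negb_or => h; exists r.
move/eqP: pq; apply; apply: (@dI r); rewrite 1?eq_sym //.
by apply: val_inj; rewrite /= !dE // apq.
Qed.

End AllowableSequence.

(** * Sorting lines by slope and abscissa *)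

Lemma increasing_enumeration (R : realDomainType) (m : nat) (s : 'I_m -> R) :
  injective s -> exists2 g : 'I_m -> 'I_m, injective g &
    forall i j : 'I_m, (i < j)%N = (s (g i) < s (g j)).
Proof.
move=> s_inj; pose c p := #|[set q | s q < s p]|.
have c_lt p : (c p < m)%N.
  rewrite -[X in (_ < X)%N]card_ord -cardsT proper_card //.
  by apply/properP; split; [exact: finset.subsetT | exists p; rewrite ?inE ?ltxx].
have c_mono p q : s p < s q -> (c p < c q)%N.
  move=> pq; rewrite proper_card //; apply/properP; split.
    by apply/fintype.subsetP => r; rewrite !inE => /lt_trans; apply.
  by exists p; rewrite !inE ?pq ?ltxx.
pose r p := Ordinal (c_lt p).
have r_inj : injective r.
  move=> p q /(congr1 val) /= e; apply: s_inj; apply/eqP.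
  by case: ltgtP => // /c_mono; rewrite e ltnn.
have [g rK gK] := injF_bij r_inj; exists g; first exact: can_inj gK.
move=> i j; rewrite -{1}(gK i) -{1}(gK j) /=.
case: (ltgtP (s (g i)) (s (g j))) => [/c_mono //|/c_mono|/s_inj ->].
  by move=> h; apply/negbTE; rewrite -leqNgt ltnW.
by rewrite ltnn.
Qed.

(** The lines y = s_p x + t_p, sorted by slope, form an allowable sequence whose steps are the
    sorted abscissas: [d p q] is the rank of the abscissa where p and q cross. *)
Lemma slopes_labelling (R : realFieldType) (m : nat) (s t x : 'I_m -> R) :
  (2 < m)%N -> injective x -> injective s ->
  (forall p q, p != q -> exists i, s p * x i + t p = s q * x i + t q) ->
  (forall p q r i, p != q -> q != r -> p != r ->
     s p * x i + t p = s q * x i + t q ->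
     s p * x i + t p = s r * x i + t r -> False) ->
  exists g h : 'I_m -> 'I_m, [/\ injective g, injective h &
    forall i j k : 'I_m, i != j -> k = ((i + j) %% m)%N :> nat ->
      s (g i) * x (h k) + t (g i) = s (g j) * x (h k) + t (g j)].
Proof.
move=> m2 x_inj s_inj cross gen.
have [gs gs_inj sE] := increasing_enumeration s_inj.
have [gx gx_inj xE] := increasing_enumeration x_inj.
have m0 : (0 < m)%N by lia.
pose S p := s (gs p); pose T p := t (gs p); pose X k := x (gx k).
pose v p k := S p * X k + T p.
(* The default is never taken for distinct lines, which cross over some abscissa by [cross]. *)
pose d p q := odflt (Ordinal m0) [pick k | v p k == v q k].
have dC p q : d p q = d q p.
  by congr odflt; apply: eq_pick => k; rewrite /= eq_sym.
have dP p q : p != q -> v p (d p q) = v q (d p q).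
  move=> pq; rewrite /d; case: pickP => [k /eqP//|no].
  have /cross[i ei] : gs p != gs q by rewrite (inj_eq gs_inj).
  have [gy gyK yK] := injF_bij gx_inj.
  by have := no (gy i); rewrite /v /X yK /S /T ei eqxx.
have dI p q r : q != p -> r != p -> d p q = d p r -> q = r.
  move=> qp rp e; apply/eqP/negPn/negP => qr.
  have e1 : v p (d p q) = v q (d p q) by apply: dP; rewrite eq_sym.
  have e2 : v p (d p q) = v r (d p q) by rewrite e; apply: dP; rewrite eq_sym.
  apply: gen e1 e2; rewrite ?(inj_eq gs_inj) //; by rewrite eq_sym.
have slope p q k : p != q -> v p k - v q k = (S p - S q) * (X k - X (d p q)).
  move=> /dP; rewrite /v => e.
  have -> : T p = S q * X (d p q) + T q - S p * X (d p q).
    by rewrite -e addrAC subrr add0r.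
  by ring.
(* [below k] is the order of the heights just to the left of the k-th abscissa: at a tie the steeper
   line is the lower one. Past the last abscissa the order is that of the slopes, which is
   [below_ge]. *)
have below_lt k (km : (k < m)%N) p q : below d k p q =
    (v p (Ordinal km) < v q (Ordinal km)) ||
    (v p (Ordinal km) == v q (Ordinal km)) && (S q < S p).
  rewrite /below; have [->|pq] := eqVneq p q; first by rewrite !ltxx andbF.
  set K := Ordinal km; have kE : k = K by [].
  have := slope p q K pq; rewrite -subr_lt0 -(subr_eq0 (v p K)) => ->.
  rewrite /= dC {1}kE sE xE mulf_eq0 !subr_eq0 -/(S p) -/(S q) -/(X _) -/(X K).
  case: (ltgtP (S p) (S q)) => [h|h|/s_inj/gs_inj/eqP]; last by rewrite (negPf pq).
    by rewrite /= andbF orbF nmulr_rlt0 ?subr_lt0 // subr_gt0.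
  rewrite /= andbT pmulr_rlt0 ?subr_gt0 // subr_lt0 orbC -le_eqVlt.
  by rewrite -leNgt.
have below_ge k p q : (m <= k)%N -> below d k p q = (S p < S q).
  move=> mk; rewrite /below (leq_trans (ltn_ord _) mk) addbT -leqNgt -sE.
  by rewrite -val_eqE /= [RHS]ltn_neqAle.
have trans k p q r : below d k p q -> below d k q r -> below d k p r.
  have [km|mk] := ltnP k m; last by rewrite !below_ge //; apply: lt_trans.
  rewrite !below_lt => /orP[h1|/andP[/eqP -> h1]] /orP[h2|/andP[/eqP <- h2]].
  - by rewrite (lt_trans h1 h2).
  - by rewrite h1.
  - by rewrite h2.
  - by rewrite eqxx (lt_trans h2 h1) orbT.
have [a [e [a_inj aE]]] := allowable_labelling dC dI trans m2.
have [b aK bK] := injF_bij a_inj.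
(* Shifting the numbering of the abscissas absorbs the offset [e]. *)
pose sh (k : 'I_m) : 'I_m := Ordinal (ltn_pmod (k + e) m0).
exists (gs \o b), (gx \o sh); split.
- by apply: inj_comp => //; apply: can_inj bK.
- apply: inj_comp => // i j ij; have /eqP := congr1 val ij; rewrite /=.
  by rewrite eqn_modDr !modn_small // => /eqP/val_inj.
move=> i j k ij kE.
have bij : b i != b j by rewrite (inj_eq (can_inj bK)).
have -> : (gx \o sh) k = gx (d (b i) (b j)).
  by congr gx; apply: val_inj; rewrite /= aE // !bK kE modnDml.
exact: dP.
Qed.

(** * Isotropic spaces of degree one elements *)

Section IsotropicSpaces.
Variables (K : fieldType) (r n : nat).
Hypothesis charK : [pchar K] =i pred0.
Local Notation V := 'rV[K]_r.
(** For [r] degree one elements, [u i] and [l i] are the vectors of their coefficients at M_i and at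
    L_i. *)
Variables u l : 'I_n.+1 -> V.

(** The form that pairwise zero products take at a flat: [z] is the sum of the coefficient vectors
    over the flat and [v] is one of them. *)
Let sameline (z v : V) := z = 0 \/ exists c, v = c *: z.

(** The next three hypotheses are the conditions at the triple points of M_i, M_j, L_(i+j), at the
    double points of M_i and L_(2i), and at the centre of the pencil of the L_i. *)
Hypothesis uul : forall i j, i != j ->
  let z := u i + u j + l (i + j) in
  [/\ sameline z (u i), sameline z (u j) & sameline z (l (i + j))].
Hypothesis ul : forall i, let z := u i + l (i + i) in
  sameline z (u i) /\ sameline z (l (i + i)).
Hypothesis ll : let z := \sum_i l i in forall i, sameline z (l i).
(** The coefficient vectors span at least three dimensions, as they do for three independent
    elements. *)
Hypothesis full : forall U : {vspace V},
  (forall i, u i \in U) -> (forall i, l i \in U) -> (2 < \dim U)%N.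

Let indep x y z := forall a b c : K,
  a *: x + b *: y + c *: z = 0 :> V -> [/\ a = 0, b = 0 & c = 0].

(** By independence [z] and [w] are not proportional and their sum is nonzero, so they are not both
    multiples of it. *)
Let indep_ul x y z w : indep x y z -> w = - (x + y) ->
  sameline (z + w) z -> sameline (z + w) w -> False.
Proof.
move=> xyz -> [e|[c zE]] H.
  by have [] := xyz (-1) (-1) 1; rewrite ?scaleN1r ?scale1r ?[RHS](esym e);
    [rewrite addrC opprD | move=> /eqP; rewrite oppr_eq0 oner_eq0].
case: H => [e|[c' wE]].
  by have [] := xyz (-1) (-1) 1; rewrite ?scaleN1r ?scale1r ?[RHS](esym e);
    [rewrite addrC opprD | move=> /eqP; rewrite oppr_eq0 oner_eq0].
have [] := xyz c c c'.
  have -> : c *: x + c *: y = c *: - (c' *: (z - (x + y))).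
    by rewrite -wE opprK scalerDr.
  by rewrite {2}zE !(scalerN, scalerA) mulrC addNr.
move=> c0 _ _; have z0 : z = 0 by rewrite zE c0 scale0r.
have [] := xyz 0 0 1; first by rewrite z0 !scale0r scaler0 !addr0.
by move=> _ _ /eqP; rewrite oner_eq0.
Qed.

Let indep_neq x y z : indep (u x) (u y) (u z) -> x != y.
Proof.
move=> h; apply/eqP => e; have [] := h 1 (-1) 0.
  by rewrite e scale0r addr0 scale1r scaleN1r subrr.
by move/eqP; rewrite oner_eq0.
Qed.

(** M_x and M_y meet on L_(x+y); as [u x] and [u y] are independent, the sum at that point is zero,
    so l(x+y) = -(u x + u y). The other line that meets M_z on L_(x+y) has index x + y - z, and
    independence of [u z] from l(x+y) makes the sum vanish there as well. *)
Let parallelogram x y z : indep (u x) (u y) (u z) ->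
  u (x + y - z) = u x + u y - u z.
Proof.
move=> xyz; have xy := indep_neq xyz.
have lE : l (x + y) = - (u x + u y).
  have [h1 h2 _] := uul xy; set s := (X in sameline X) in h1 h2.
  have [s0|s0] := eqVneq s 0.
    by apply/eqP; rewrite -addr_eq0 addrC; apply/eqP.
  case: h1 => [/eqP|[a aE]]; first by rewrite (negPf s0).
  case: h2 => [/eqP|[b bE]]; first by rewrite (negPf s0).
  have [] := xyz b (- a) 0.
    by rewrite aE bE scale0r addr0 !scalerA mulNr mulrC scaleNr subrr.
  move=> b0 _ _; have y0 : u y = 0 by rewrite bE b0 scale0r.
  have [] := xyz 0 1 0; first by rewrite y0 !scale0r scaler0 !addr0.
  by move=> _ /eqP; rewrite oner_eq0.
(* If 2z = x + y, then M_z meets L_(x+y) in a double point, where [u z] and l(x+y) would have to be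
   proportional. *)
have [zz|zw] := eqVneq z (x + y - z).
  have e : z + z = x + y by rewrite {1}zz subrK.
  have [h1 h2] := ul z; rewrite e in h1 h2.
  by case: (indep_ul xyz lE h1 h2).
have e : z + (x + y - z) = x + y by rewrite addrC subrK.
have := uul zw; rewrite e; set w := x + y - z => -[h1 h2 h3].
set s := u z + u w + l (x + y) in h1 h2 h3.
have [s0|s0] := eqVneq s 0.
  have -> : u w = s - l (x + y) - u z.
    by rewrite /s; apply/rowP => ?; rewrite !mxE; ring.
  by rewrite s0 lE sub0r opprK.
case: h1 => [/eqP|[a aE]]; first by rewrite (negPf s0).
case: h3 => [/eqP|[b bE]]; first by rewrite (negPf s0).
have H c v : v = c *: s -> sameline (u z + l (x + y)) v.
  move=> vE; rewrite aE bE -scalerDl.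
  have [->|ab] := eqVneq (a + b) 0; first by left; rewrite scale0r.
  by right; exists (c / (a + b)); rewrite scalerA divfK.
by case: (indep_ul xyz lE (H _ _ aE) (H _ _ bE)).
Qed.

(** Through the points of M_a with [u a] nonzero, every [l k] lies in the span of the [u i]; hence
    the [u i] alone span three dimensions. *)
Let indep_full : (exists a, u a != 0) ->
  exists a b c, indep (u a) (u b) (u c).
Proof.
case=> a a0.
have lin (U : {vspace V}) : (forall i, u i \in U) -> forall k, l k \in U.
  move=> uU k; have [e|ka] := eqVneq a (k - a).
    have -> : k = a + a by rewrite {1}e subrK.
    have [h1 h2] := ul a; set s := (X in sameline X) in h1 h2.
    have [s0|s0] := eqVneq s 0.
      have -> : l (a + a) = - u a by apply/eqP; rewrite -addr_eq0 addrC; apply/eqP.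
      by rewrite memvN.
    case: h1 => [/eqP|[c cE]]; first by rewrite (negPf s0).
    case: h2 => [/eqP|[d ->]]; first by rewrite (negPf s0).
    have c0 : c != 0 by apply: contraNneq a0 => c0; rewrite cE c0 scale0r.
    have -> : s = c^-1 *: u a by rewrite cE scalerA mulVf // scale1r.
    by rewrite !memvZ.
  have [] := uul ka; have -> : a + (k - a) = k by rewrite addrC subrK.
  set s := (X in sameline X) => h1 _ h2.
  have [s0|s0] := eqVneq s 0.
    have -> : l k = - (u a + u (k - a)).
      by apply/eqP; rewrite -addr_eq0 addrC; apply/eqP.
    by rewrite memvN memvD.
  case: h1 => [/eqP|[c cE]]; first by rewrite (negPf s0).
  case: h2 => [/eqP|[d ->]]; first by rewrite (negPf s0).
  have c0 : c != 0 by apply: contraNneq a0 => c0; rewrite cE c0 scale0r.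
  have -> : s = c^-1 *: u a by rewrite cE scalerA mulVf // scale1r.
  by rewrite !memvZ.
have full' (U : {vspace V}) : (\dim U <= 2)%N -> exists i, u i \notin U.
  move=> dU; apply/existsP; apply: contraLR dU => /existsPn h.
  have uU i : u i \in U by have := h i; rewrite negbK.
  by rewrite -ltnNge full // => k; apply: lin.
have dl (v : V) : (\dim <[v]> <= 1)%N by rewrite dim_vline; case: (v != 0).
have [b bP] := full' <[u a]>%VS (leq_trans (dl _) (leqnSn 1)).
have [c cP] := full' (<[u a]> + <[u b]>)%VS
  (leq_trans (dimv_add_leqif _ _).1 (leq_add (dl _) (dl _))).
exists a, b, c => x y z e.
have z0 : z = 0.
  apply/eqP; apply: contraNT cP => z0.
  have -> : u c = - z^-1 *: (x *: u a + y *: u b).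
    rewrite -[x *: _ + _](addrK (z *: u c)) e sub0r scalerN scaleNr opprK scalerA.
    by rewrite mulVf // scale1r.
  by rewrite memvZ // memv_add // memvZ // memv_line.
have y0 : y = 0.
  apply/eqP; apply: contraNT bP => y0.
  have -> : u b = - y^-1 *: (x *: u a).
    move: e; rewrite z0 scale0r addr0 => e.
    rewrite -[x *: _](addrK (y *: u b)) e sub0r scalerN scaleNr opprK scalerA.
    by rewrite mulVf // scale1r.
  by rewrite !memvZ // memv_line.
split=> //; move: e; rewrite y0 z0 !scale0r !addr0 => /eqP.
by rewrite scaler_eq0 (negPf a0) orbF => /eqP.
Qed.

(* From three independent values, completing parallelograms makes u affine
   along an arithmetic progression of the cyclic group, which is impossible in
   characteristic 0. *)
Lemma isotropic_pencil : (forall i, u i = 0) /\ \sum_i l i = 0.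
Proof.
have u0 : forall i, u i = 0.
  have [/existsP ex|/existsPn no] := boolP [exists a, u a != 0]; last first.
    by move=> i; apply/eqP; rewrite -[_ == _]negbK no.
  have [a [b [c abc]]] := indep_full ex; exfalso.
  pose D := u c - u a.
  have uc : u c = u a + D by rewrite addrC subrK.
  have ind x y z : x *: u a + y *: u b + z *: D = 0 -> [/\ x = 0, y = 0 & z = 0].
    move=> e; have [] := abc (x - z) y z.
      rewrite -e uc; apply/rowP => ?; rewrite !mxE; ring.
    by move=> xz -> z0; move: xz; rewrite z0 subr0.
  have shift (x y z w : 'I_n.+1) : x + (z + w) = x + w + (y + (z + w)) - (y + w).
    by rewrite [y + (z + w)]addrCA [x + w + _]addrA addrK -addrA [w + z]addrC.
  (* With a_k = a + k(c - a) and b_k = b + k(c - a), the parallelograms on a_k, a_(k+1), b_k and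
     then on b_k, b_(k+1), a_(k+1) prolong both progressions, each time by the vector [D]. *)
  have aff k : [/\ u (a + (c - a) *+ k) = u a + k%:R *: D,
                  u (b + (c - a) *+ k) = u b + k%:R *: D &
                  u (a + (c - a) *+ k.+1) = u a + k.+1%:R *: D].
    elim: k => [|k [IHa IHb IHc]].
      by rewrite !mulr0n !scale0r !addr0 scale1r -uc [_ + (c - a)]addrC subrK.
    have IHb' : u (b + (c - a) *+ k.+1) = u b + k.+1%:R *: D.
      have -> : b + (c - a) *+ k.+1 =
          (b + (c - a) *+ k) + (a + (c - a) *+ k.+1) - (a + (c - a) *+ k).
        by rewrite mulrS; apply: shift.
      rewrite parallelogram ?IHa ?IHb ?IHc; last first.
        move=> x y z e; have [] := ind (y + z) x ((x + y + z) * k%:R + y).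
          by rewrite -e -natr1; apply/rowP => ?; rewrite !mxE; ring.
        move=> yz0 x0; rewrite x0 add0r yz0 mul0r add0r => y0.
        by move: yz0; rewrite y0 add0r.
      by rewrite -natr1; apply/rowP => ?; rewrite !mxE; ring.
    split=> //.
    have -> : a + (c - a) *+ k.+2 =
        (a + (c - a) *+ k.+1) + (b + (c - a) *+ k.+1) - (b + (c - a) *+ k).
      rewrite [X in b + X]mulrS -addrA [X in _ + (X - _)]addrCA addrK -addrA.
      by rewrite -mulrSr.
    rewrite parallelogram ?IHb' ?IHb ?IHc; last first.
      move=> x y z e; have [] := ind x (y + z) ((x + y + z) * k%:R + x + y).
        by rewrite -e -natr1; apply/rowP => ?; rewrite !mxE; ring.
      move=> x0 yz0; rewrite x0 add0r yz0 mul0r !add0r => y0.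
      by move: yz0; rewrite y0 add0r.
    by rewrite -[k.+2%:R]natr1 -natr1; apply/rowP => ?; rewrite !mxE; ring.
  (* After [n.+1] steps the progression is back at [a], so (n+1) D = 0, hence D = 0 in
     characteristic 0. *)
  have [+ _ _] := aff n.+1.
  have -> : (c - a) *+ n.+1 = 0.
    by apply: val_inj; rewrite Zp_mulrn /= modnMl.
  rewrite addr0 => /esym/eqP; rewrite -subr_eq0 addrAC subrr add0r scaler_eq0.
  rewrite (pcharf0P K).1 //= => /eqP D0.
  have [] := ind 0 0 1; first by rewrite D0 !scale0r scaler0 !addr0.
  by move=> _ _ /eqP; rewrite oner_eq0.
(* With all [u i] zero and [s] nonzero, every [l i] would be a multiple of [s], and the span would
   be a line. *)
split=> //; set s := \sum_i l i; apply/eqP; apply: contraT => s0.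
have := full (U := <[s]>%VS); rewrite dim_vline s0 => h.
have : (2 < 1)%N; last by [].
apply: h => i; first by rewrite u0 mem0v.
have [/eqP|[c ->]] := ll i; first by rewrite -/s (negPf s0).
by rewrite memvZ // memv_line.
Qed.

End IsotropicSpaces.

(** * Orlik-Solomon ideals in low degree *)

Section ExteriorDegreeTwo.
Variables (K : fieldType) (I : finType).
Implicit Types (x y z a b g : ext K I) (S T U : {set I}).

(** [os_ideal] with the geometry forgotten: it is convertible to the case where [dep] is
    [os_dependent]. *)
Definition gen_ideal (dep : pred {set I}) : {vspace ext K I} :=
  (\sum_(S | dep S) ({:ext K I} * <[ext_bd K S]> * {:ext K I}))%VS.

Lemma mem_gen_ideal (dep : pred {set I}) a b S : dep S ->
  a * ext_bd K S * b \in gen_ideal dep.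
Proof.
move=> dS; apply: (subvP (sumv_sup S dS (subvv _))).
by rewrite !memv_mul ?memvf ?memv_line.
Qed.

Lemma gen_ideal_ker (W : vectType K) (f : ext K I -> W) (dep : pred {set I}) :
  linear f -> (forall S a b, dep S -> f (a * ext_bd K S * b) = 0) ->
  forall x, x \in gen_ideal dep -> f x = 0.
Proof.
move=> lf f0 x.
pose g : {linear ext K I -> W} := HB.pack f (GRing.isLinear.Build K _ _ _ f lf).
suff /subvP h : (gen_ideal dep <= lker (linfun g))%VS.
  by move/h; rewrite memv_ker lfunE => /eqP.
apply/subv_sumP => S dS; apply/prodvP => u b uS _.
have lb : linear (fun v => f (v * b)) by move=> c v w; rewrite mulrDl -scalerAl lf.
pose gb : {linear ext K I -> W} :=
  HB.pack (fun v => f (v * b)) (GRing.isLinear.Build K _ _ _ _ lb).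
have: u \in lker (linfun gb); last by rewrite !memv_ker !lfunE.
move: uS; apply: subvP; apply/prodvP => a _ _ /vlineP[c ->].
rewrite memv_ker lfunE -scalerAr linearZ /=.
by rewrite f0 // scaler0.
Qed.

(** The kernel version applies to [f] minus its projection to [U]. *)
Lemma gen_ideal_map (W : vectType K) (f : ext K I -> W) (dep : pred {set I})
    (U : {vspace W}) :
  linear f -> (forall S a b, dep S -> f (a * ext_bd K S * b) \in U) ->
  forall x, x \in gen_ideal dep -> f x \in U.
Proof.
move=> lf fU x xI.
have lg : linear (fun z => f z - projv U (f z)).
  move=> c u v; rewrite lf linearD linearZ /= scalerBr opprD addrACA.
  by [].
suff /eqP : f x - projv U (f x) = 0 by rewrite subr_eq0 => /eqP ->; apply: memv_proj.
apply: gen_ideal_ker lg _ _ xI => S a b dS.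
by rewrite projv_id ?subrr // fU.
Qed.

Definition ext_coef x (i : I) : K := x [set i].

Lemma ext_homog1E x : ext_homog 1 x -> x = \sum_i ext_coef x i *: ext_base K [set i].
Proof.
move=> hx; apply/ffunP => S; rewrite sum_ffunE.
have [/cards1P[i ->]|S1] := boolP (#|S| == 1%N).
  rewrite (bigD1 i) //= big1 => [|j ji]; rewrite !ffunE.
    by rewrite eqxx /GRing.scale /= mulr1 addr0.
  by rewrite (inj_eq set1_inj) eq_sym (negPf ji) scaler0.
rewrite hx // big1 // => i _; rewrite !ffunE.
by case: (eqVneq S [set i]) S1 => [->|_]; rewrite ?cards1 // scaler0.
Qed.

(* The alternating bilinear form underlying the degree two part of z. *)
Definition ext_form z (i j : I) : K :=
  if i == j then 0 else (-1) ^+ (enum_rank j < enum_rank i)%N * z [set i; j].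

Lemma inversions_1_1 (i j : I) :
  inversions [set i] [set j] = (enum_rank j < enum_rank i)%N.
Proof. by rewrite /inversions !big_set1. Qed.

Lemma enum_rank_flip (i j : I) : i != j ->
  (enum_rank j < enum_rank i)%N = ~~ (enum_rank i < enum_rank j)%N.
Proof.
move=> ij; have : enum_rank i != enum_rank j by rewrite (inj_eq enum_rank_inj).
by rewrite -val_eqE /=; lia.
Qed.

Lemma ext_form_mul x y i j : ext_homog 1 x -> ext_homog 1 y ->
  ext_form (x * y) i j =
    ext_coef x i * ext_coef y j - ext_coef x j * ext_coef y i.
Proof.
move=> hx hy; rewrite /ext_coef /ext_form; have [->|ij] := eqVneq i j; first by rewrite subrr.
have ji : j \notin [set i] by rewrite inE eq_sym.
have i_j : i \notin [set j] by rewrite inE.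
have si : [set i; j] :\: [set i] = [set j] by rewrite setU1K.
have sj : [set i; j] :\: [set j] = [set i] by rewrite setUC setU1K.
rewrite [(x * y) _]ffunE (bigD1 [set i]) ?sub1set ?inE ?eqxx //=.
rewrite (bigD1 [set j]) ?sub1set ?inE ?eqxx ?orbT ?(inj_eq set1_inj) 1?eq_sym //=.
rewrite big1 ?addr0 => [|S /andP[/andP[Sij Si] Sj]]; last first.
  rewrite hx ?mul0r ?mulr0 //; apply/negP => /cards1P[k kS].
  by move: Sij Si Sj; rewrite kS sub1set !inE !(inj_eq set1_inj) => /orP[->|->].
rewrite si sj !inversions_1_1 (enum_rank_flip ij).
by case: (_ < _)%N; rewrite /= ?expr0 ?expr1; ring.
Qed.

(** The alternating form contracted with the indicator of [T]. For a flat [T] containing [j] it is a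
    linear functional that kills the ideal. *)
Definition ext_trace T j z : K := \sum_(i in T) ext_form z i j.

Lemma ext_form_linear i j (c : K) x y :
  ext_form (c *: x + y) i j = c * ext_form x i j + ext_form y i j.
Proof.
rewrite /ext_form; case: eqP => _; first by rewrite mulr0 addr0.
by rewrite !ffunE /GRing.scale /=; ring.
Qed.

Lemma ext_trace_linear T j : linear (ext_trace T j : ext K I -> K^o).
Proof.
move=> c x y; rewrite /ext_trace scaler_sumr -big_split /=.
by apply: eq_bigr => i _; rewrite ext_form_linear.
Qed.

(** In its lowest degree [g] can only be multiplied by the constant term of the other factor. *)
Lemma ext_mul_lowl g b U : (forall T, (#|T| < #|U|)%N -> g T = 0) ->
  (g * b) U = g U * b set0.
Proof.
move=> g0; rewrite ffunE (bigD1 U) //= big1 => [|S /andP[SU SneU]]; last first.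
  by rewrite g0 ?mul0r ?mulr0 // proper_card // properEneq SneU.
by rewrite setDv inversions0r mul1r addr0.
Qed.

Lemma ext_mul_lowr g a U : (forall T, (#|T| < #|U|)%N -> g T = 0) ->
  (a * g) U = a set0 * g U.
Proof.
move=> g0; rewrite ffunE (bigD1 set0) ?sub0set //= big1 => [|S /andP[SU S0]].
  by rewrite setD0 inversions0l mul1r addr0.
rewrite g0 ?mulr0 // proper_card // properEneq subsetDl andbT.
apply: contraNneq S0 => /setDidPl; rewrite disjoint_sym => dSU.
by rewrite -subset0 -(disjoint_setI0 dSU) subsetI subxx.
Qed.

Lemma ext_bd_card S T : #|T|.+1 != #|S| -> ext_bd K S T = 0.
Proof.
move=> TS; rewrite sum_ffunE big1 // => i iS; rewrite !ffunE.
case: (eqVneq T (S :\ i)) TS => [->|_]; rewrite ?scaler0 //.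
by rewrite [#|S|](cardsD1 i) iS eqxx.
Qed.

Lemma ext_bd_sub S T : ~~ (T \subset S) -> ext_bd K S T = 0.
Proof.
move=> TS; rewrite sum_ffunE big1 // => i iS; rewrite !ffunE.
by case: (eqVneq T (S :\ i)) TS => [->|_]; rewrite ?scaler0 // subsetDl.
Qed.

Lemma ext_bd3 (j p q : I) : j != p -> j != q -> p != q ->
  ext_bd K [set j; p; q] [set p; j] =
    (-1) ^+ ((enum_rank j < enum_rank q) + (enum_rank p < enum_rank q))%N.
Proof.
move=> jp jq pq; rewrite sum_ffunE (bigD1 q) ?inE ?eqxx ?orbT //=.
have -> : [set j; p; q] :\ q = [set p; j].
  apply/setP => k; rewrite !inE orbC; case: (eqVneq k q) => [->|_] /=.
    by rewrite ![q == _]eq_sym (negPf jq) (negPf pq).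
  by rewrite orbC.
rewrite big1 ?addr0 => [|i /andP[iS iq]]; rewrite !ffunE ?eqxx.
  rewrite /GRing.scale /= mulr1; congr (_ ^+ _).
  rewrite /inversions big_set1 setUC big_setU1 /=; last first.
    by rewrite !inE negb_or ![q == _]eq_sym jq.
  by rewrite big_setU1 ?inE //= big_set1 ltnn add0n.
case: (eqVneq [set p; j] _) => [e|_]; last by rewrite scaler0.
have : q \in [set p; j] by rewrite e !inE eqxx orbT eq_sym iq.
by rewrite !inE ![q == _]eq_sym (negPf jq) (negPf pq).
Qed.

Section LocalCriterion.
Variables (dep : pred {set I}) (T : {set I}).
Hypothesis dep3 : forall S, dep S -> (2 < #|S|)%N.
Hypothesis flatT : forall i j k, i \in T -> j \in T -> i != j ->
  dep [set i; j; k] -> k \in T.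

(** Only triples {j, p, q} contribute. A flat through [j] contains both [p] and [q] or neither, and
    when it contains both their terms have opposite signs. *)
Lemma ext_trace_bd S j : dep S -> j \in T -> ext_trace T j (ext_bd K S) = 0.
Proof.
move=> dS jT; have [S3|S3] := eqVneq #|S| 3%N; last first.
  rewrite /ext_trace big1 // => i _; rewrite /ext_form; case: (eqVneq i j) => // ij.
  by rewrite ext_bd_card ?mulr0 // cards2 ij eq_sym.
have [jS|jS] := boolP (j \in S); last first.
  rewrite /ext_trace big1 // => i _; rewrite /ext_form; case: (eqVneq i j) => // ij.
  rewrite ext_bd_sub ?mulr0 //; apply: contra jS => /subsetP; apply.
  by rewrite !inE eqxx orbT.
have /cards2P[p [q [pq SE]]] : #|S :\ j| == 2%N.
  by have := cardsD1 j S; rewrite jS S3 => /eqP; rewrite add1n eqSS eq_sym.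
have jp : j != p.
  by have : p \in S :\ j by [rewrite SE !inE eqxx]; rewrite !inE eq_sym => /andP[].
have jq : j != q.
  have : q \in S :\ j by rewrite SE !inE eqxx orbT.
  by rewrite !inE eq_sym => /andP[].
have {}SE : S = [set j; p; q] by rewrite -setUA -SE setD1K.
have pqT : (p \in T) = (q \in T).
  apply/idP/idP => h.
    by apply: (@flatT j p) => //; rewrite -SE.
  by apply: (@flatT j q) => //; rewrite setUAC -SE.
have bd0 i : i != p -> i != q -> i \in T -> ext_form (ext_bd K S) i j = 0.
  move=> ip iq iT; rewrite /ext_form; case: (eqVneq i j) => // ij.
  rewrite ext_bd_sub ?mulr0 //; apply/negP => /subsetP /(_ i).
  by rewrite SE !inE eqxx (negPf ip) (negPf iq) (negPf ij) => /(_ isT).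
rewrite /ext_trace; case: (boolP (p \in T)) pqT => pT /esym qT; last first.
  rewrite big1 // => i iT; apply: bd0 => //; apply: contraTneq iT => -> //.
  by rewrite qT.
rewrite (bigD1 p) //= (bigD1 q) /=; last by rewrite qT eq_sym.
rewrite big1 ?addr0 => [|i /andP[/andP[iT ip] iq]]; last exact: bd0.
rewrite /ext_form ![_ == j]eq_sym (negPf jp) (negPf jq) SE ext_bd3 //.
rewrite setUAC ext_bd3 // 1?eq_sym // (enum_rank_flip pq) !exprD.
by case: (_ < _)%N; case: (_ < _)%N; case: (_ < _)%N;
  rewrite /= ?expr0 ?expr1; ring.
Qed.

Lemma ext_trace_gen_ideal j x : j \in T -> x \in gen_ideal dep ->
  ext_trace T j x = 0.
Proof.
move=> jT; apply: (gen_ideal_ker (W := K^o)) => [|S a b dS].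
  exact: ext_trace_linear.
have low U : (#|U| < 2)%N -> ext_bd K S U = 0.
  by move=> U2; apply: ext_bd_card; have := dep3 dS; lia.
have lowa U : (#|U| < 2)%N -> (a * ext_bd K S) U = 0.
  move=> U2; rewrite ext_mul_lowr ?low ?mulr0 // => V UV.
  by rewrite low // (ltn_trans UV).
have formE i : ext_form (a * ext_bd K S * b) i j =
    a set0 * b set0 * ext_form (ext_bd K S) i j.
  rewrite /ext_form; case: (eqVneq i j) => [|ij]; first by rewrite mulr0.
  rewrite ext_mul_lowl => [|U]; last by rewrite cards2 ij; apply: lowa.
  rewrite ext_mul_lowr => [|U]; last by rewrite cards2 ij; apply: low.
  by ring.
rewrite /ext_trace; under eq_bigr => i _ do rewrite formE.
by rewrite -mulr_sumr -/(ext_trace T j _) ext_trace_bd // mulr0.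
Qed.

(** The form of a product is x_i y_j - x_j y_i, and its trace over the flat vanishes. For several
    elements this is the source of the [sameline] conditions. *)
Lemma gen_ideal_local x y j : ext_homog 1 x -> ext_homog 1 y ->
  x * y \in gen_ideal dep -> j \in T ->
  (\sum_(i in T) ext_coef x i) * ext_coef y j =
  (\sum_(i in T) ext_coef y i) * ext_coef x j.
Proof.
move=> hx hy xy jT; have := ext_trace_gen_ideal jT xy; rewrite /ext_trace.
under eq_bigr => i _ do rewrite ext_form_mul //.
rewrite sumrB -mulr_suml -mulr_sumr => /eqP; rewrite subr_eq0 => /eqP ->.
by rewrite mulrC.
Qed.

End LocalCriterion.

(** The boundary of a dependent set has degree at least two, so the ideal has no terms of lower
    degree. *)
Lemma gen_ideal_homog1 (dep : pred {set I}) x :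
  (forall S, dep S -> (2 < #|S|)%N) ->
  ext_homog 1 x -> x \in gen_ideal dep -> x = 0.
Proof.
move=> dep3 hx xI; apply/ffunP => U; rewrite [RHS]ffunE.
have [U1|] := eqVneq #|U| 1%N; last exact: hx.
apply: (gen_ideal_ker (W := K^o) (f := fun z => z U)) xI => [c u v|S a b dS].
  by rewrite !ffunE.
have low (V : {set I}) : (#|V| < 2)%N -> ext_bd K S V = 0.
  by move=> U2; apply: ext_bd_card; have := dep3 _ dS; lia.
rewrite ext_mul_lowl => [|V VU]; rewrite ext_mul_lowr => [|W WV];
  by rewrite low ?mulr0 ?mul0r //; lia.
Qed.

Lemma ext_base_mul S T : [disjoint S & T] ->
  ext_base K S * ext_base K T = (-1) ^+ inversions S T *: ext_base K (S :|: T).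
Proof.
move=> dST; apply/ffunP => U; rewrite [LHS]ffunE ![in RHS]ffunE.
have [->|UST] := eqVneq U (S :|: T).
  rewrite (bigD1 S) ?subsetUl //= big1 ?addr0 => [|V /andP[_ VS]].
    rewrite !ffunE setDUl setDv set0U (setDidPl _) 1?disjoint_sym // !eqxx.
    by rewrite /GRing.scale /= !mulr1.
  by rewrite !ffunE (negPf VS) mul0r mulr0.
rewrite scaler0 big1 // => V VU; rewrite !ffunE.
case: (eqVneq V S) VU => [-> SU|_ _]; last by rewrite mul0r mulr0.
case: (eqVneq (U :\: S) T) UST => [<-|]; last by rewrite !mulr0.
by rewrite setDE setUIr setUCr setIT (setUidPr SU) eqxx.
Qed.

Lemma ext_base1_sq (i : I) : ext_base K [set i] * ext_base K [set i] = 0.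
Proof.
apply/ffunP => U; rewrite !ffunE big1 // => V VU; rewrite !ffunE.
case: (eqVneq V [set i]) => [->|]; last by rewrite mul0r mulr0.
case: (eqVneq (U :\ i) [set i]) => [/setP/(_ i)|]; last by rewrite !mulr0.
by rewrite !inE eqxx.
Qed.

Lemma ext_base1_mul (i j : I) : i != j -> ext_base K [set i] * ext_base K [set j] =
  (-1) ^+ (enum_rank j < enum_rank i)%N *: ext_base K [set i; j].
Proof.
move=> ij; rewrite ext_base_mul ?inversions_1_1 //.
by rewrite disjoints1 inE.
Qed.

Lemma ext_base1_anti (i j : I) : ext_base K [set i] * ext_base K [set j] =
  - (ext_base K [set j] * ext_base K [set i]).
Proof.
have [->|ij] := eqVneq i j; first by rewrite ext_base1_sq oppr0.
rewrite !ext_base1_mul // 1?eq_sym // [[set j; i]]setUC (enum_rank_flip ij).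
by case: (_ < _)%N; rewrite /= ?expr0 ?expr1 ?scaleN1r ?scale1r ?opprK.
Qed.

Lemma ext_bd3_mul (o i j : I) : o != i -> o != j -> i != j ->
  (ext_base K [set i] - ext_base K [set o]) *
  (ext_base K [set j] - ext_base K [set o]) =
  (-1) ^+ ((enum_rank i < enum_rank o) + (enum_rank j < enum_rank o) +
           (enum_rank j < enum_rank i))%N *: ext_bd K [set o; i; j].
Proof.
move=> oi oj ij; rewrite mulrBl !mulrBr ext_base1_sq subr0.
rewrite !ext_base1_mul // 1?eq_sym //.
rewrite /ext_bd [in RHS]setUC.
rewrite big_setU1 /=; last by rewrite !inE negb_or ![j == _]eq_sym oj.
rewrite big_setU1 ?inE //= big_set1.
have D1 : (j |: [set o; i]) :\ j = [set i; o].
  apply/setP => k; rewrite !inE; case: (eqVneq k j) => [->|_] /=.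
    by rewrite ![j == _]eq_sym (negPf ij) (negPf oj).
  by rewrite orbC.
have D2 : (j |: [set o; i]) :\ o = [set i; j].
  apply/setP => k; rewrite !inE; case: (eqVneq k o) => [->|_] /=.
    by rewrite (negPf oi) (negPf oj).
  by rewrite orbC.
have D3 : (j |: [set o; i]) :\ i = [set o; j].
  apply/setP => k; rewrite !inE; case: (eqVneq k i) => [->|_] /=.
    by rewrite [i == o]eq_sym (negPf oi) (negPf ij).
  by rewrite orbF orbC.
have inv3 k : inversions [set k] (j |: [set o; i]) =
  ((enum_rank j < enum_rank k) + ((enum_rank o < enum_rank k) +
   (enum_rank i < enum_rank k)))%N.
  rewrite /inversions big_set1 big_setU1 /=; last first.
    by rewrite !inE negb_or ![j == _]eq_sym oj.
  by rewrite big_setU1 ?inE //= big_set1.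
rewrite D1 D2 D3 !inv3 !ltnn (enum_rank_flip oi) (enum_rank_flip oj).
rewrite (enum_rank_flip ij).
set x := ext_base _ _; set y := ext_base _ _; set z := ext_base _ _.
clearbody x y z; apply/ffunP => U; rewrite !ffunE /GRing.scale /=.
by case: (_ < _)%N; case: (_ < _)%N; case: (_ < _)%N;
  rewrite /= ?addn0 ?add0n ?expr0 ?expr1 ?exprD ?expr1; ring.
Qed.

(** Elements of coefficient sum zero are combinations of the differences e_i - e_k0 for a fixed [k0]
    in [T], and by [ext_bd3_mul] a product of two such differences is, up to sign, the boundary of a
    dependent triple or zero. *)
Lemma gen_ideal_pencil (dep : pred {set I}) (T : {set I}) x y :
  (forall i j k, i \in T -> j \in T -> k \in T -> i != j -> i != k -> j != k ->
     dep [set i; j; k]) ->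
  ext_homog 1 x -> ext_homog 1 y ->
  (forall i, i \notin T -> ext_coef x i = 0) ->
  (forall i, i \notin T -> ext_coef y i = 0) ->
  \sum_i ext_coef x i = 0 -> \sum_i ext_coef y i = 0 ->
  x * y \in gen_ideal dep.
Proof.
move=> depT hx hy xT yT sx sy.
have [T0|/set0Pn[k0 k0T]] := eqVneq T set0.
  rewrite (ext_homog1E hx) big1 ?mul0r ?mem0v // => i _.
  by rewrite xT ?scale0r // T0 inE.
pose e i := ext_base K [set i] - ext_base K [set k0].
have zE z : ext_homog 1 z -> (forall i, i \notin T -> ext_coef z i = 0) ->
    \sum_i ext_coef z i = 0 -> z = \sum_(i in T) ext_coef z i *: e i.
  move=> hz zT sz; rewrite {1}(ext_homog1E hz).
  have {1}-> : \sum_i ext_coef z i *: ext_base K [set i] =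
      \sum_i ext_coef z i *: e i.
    under [RHS]eq_bigr => i _ do rewrite scalerBr.
    by rewrite sumrB -scaler_suml sz scale0r subr0.
  rewrite [LHS](bigID [in T]) /= [X in _ + X]big1 ?addr0 // => i iT.
  by rewrite zT // scale0r.
rewrite (zE x) // (zE y) // mulr_suml; apply: memv_suml => i iT.
rewrite mulr_sumr; apply: memv_suml => j jT.
rewrite -scalerAl -scalerAr !memvZ // /e.
have [->|io] := eqVneq i k0; first by rewrite subrr mul0r mem0v.
have [->|jo] := eqVneq j k0; first by rewrite subrr mulr0 mem0v.
have [->|ij] := eqVneq i j.
  rewrite mulrBl !mulrBr !ext_base1_sq subr0 sub0r.
  by rewrite [X in - X - _]ext_base1_anti opprK subrr mem0v.
rewrite ext_bd3_mul // 1?eq_sym // memvZ //.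
rewrite -[X in X \in _]mulr1 -[X in X * 1]mul1r mem_gen_ideal // depT //.
- by rewrite eq_sym.
- by rewrite eq_sym.
Qed.

End ExteriorDegreeTwo.

(** * Relabelling the exterior algebra *)

Section ExteriorRelabelling.
Variables (K : fieldType) (I J : finType) (phi : I -> J).
Hypothesis phi_bij : bijective phi.
Implicit Types (x y : ext K I) (S T : {set I}).

Let phi_inj : injective phi := bij_inj phi_bij.

Let flip (i j : I) : nat :=
  ((enum_rank i < enum_rank j) && (enum_rank (phi j) < enum_rank (phi i)))%N.

Let flips S T : nat := \sum_(i in S) \sum_(j in T) flip i j.

(* The sign by which phi, not being monotone, changes the ordered product e_S. *)
Let eps S : K := (-1) ^+ flips S S.

Let preimK S : phi @^-1: (phi @: S) = S.
Proof. by apply/setP => i; rewrite inE mem_imset. Qed.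

Let imK (U : {set J}) : phi @: (phi @^-1: U) = U.
Proof.
have [psi phiK psiK] := phi_bij.
apply/setP => j; rewrite -(psiK j) mem_imset // inE.
by [].
Qed.

Let inversions_im S T : inversions (phi @: S) (phi @: T) =
  (\sum_(i in S) \sum_(j in T) (enum_rank (phi j) < enum_rank (phi i)))%N.
Proof.
rewrite /inversions big_imset /=; last by move=> ? ? _ _; apply: phi_inj.
by apply: eq_bigr => i _; rewrite big_imset //= => ? ? _ _; apply: phi_inj.
Qed.

Let flipsUl (S T U : {set I}) : [disjoint S & T] -> flips (S :|: T) U = (flips S U + flips T U)%N.
Proof.
by move=> dST; rewrite /flips (eq_bigl _ _ (fun k => in_setU k _ _)) bigU.
Qed.

Let flipsUr (S T U : {set I}) : [disjoint T & U] -> flips S (T :|: U) = (flips S T + flips S U)%N.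
Proof.
move=> dTU; rewrite /flips -big_split /=; apply: eq_bigr => i _.
by rewrite (eq_bigl _ _ (fun k => in_setU k _ _)) bigU.
Qed.

Let flipsE S T : [disjoint S & T] ->
  (flips S T + flips T S + inversions S T =
   inversions (phi @: S) (phi @: T) + (flips T S).*2)%N.
Proof.
move=> dST; rewrite inversions_im /inversions -addnn.
have -> : flips T S = (\sum_(i in S) \sum_(j in T) flip j i)%N.
  by rewrite /flips exchange_big.
rewrite /flips -!big_split /=; apply: eq_bigr => i iS.
rewrite -!big_split /=; apply: eq_bigr => j jT.
have ij : i != j.
  by apply: contraTneq jT => <-; rewrite (disjointFr dST iS).
have pij : phi i != phi j by rewrite (inj_eq phi_inj).
rewrite /flip (enum_rank_flip ij) (enum_rank_flip pij).
by case: (_ < _)%N; case: (_ < _)%N.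
Qed.

(** Pairs reversed by [phi] lie within [S], within [T] or across; the last ones account for the
    change of the shuffle sign. This makes [ext_map] multiplicative. *)
Let epsU S T : [disjoint S & T] ->
  eps (S :|: T) * (-1) ^+ inversions S T =
  eps S * eps T * (-1) ^+ inversions (phi @: S) (phi @: T).
Proof.
move=> dST; rewrite /eps -!exprD flipsUl // !flipsUr //.
have -> : (flips S S + flips S T + (flips T S + flips T T) + inversions S T =
  flips S S + flips T T + inversions (phi @: S) (phi @: T) + (flips T S).*2)%N.
  by have := flipsE dST; lia.
by rewrite exprD -muln2 mulnC exprM sqrrN expr1n expr1n mulr1.
Qed.

Let eps_sq S : eps S * eps S = 1.
Proof. by rewrite /eps -expr2 sqrr_sign. Qed.

(** The algebra isomorphism that sends e_i to e_(phi i), in coordinates. *)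
Definition ext_map x : ext K J :=
  [ffun U : {set J} => eps (phi @^-1: U) * x (phi @^-1: U)].

Definition ext_unmap (y : ext K J) : ext K I :=
  [ffun S : {set I} => eps S * y (phi @: S)].

Lemma ext_mapK : cancel ext_map ext_unmap.
Proof. by move=> x; apply/ffunP => S; rewrite !ffunE preimK mulrA eps_sq mul1r. Qed.

Lemma ext_unmapK : cancel ext_unmap ext_map.
Proof. by move=> x; apply/ffunP => S; rewrite !ffunE imK mulrA eps_sq mul1r. Qed.

Lemma ext_map_linear : linear ext_map.
Proof.
by move=> c x y; apply/ffunP => U; rewrite !ffunE /GRing.scale /=; ring.
Qed.

Lemma ext_unmap_linear : linear ext_unmap.
Proof.
by move=> c x y; apply/ffunP => S; rewrite !ffunE /GRing.scale /=; ring.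
Qed.

Lemma ext_mapZ (c : K) x : ext_map (c *: x) = c *: ext_map x.
Proof. by apply/ffunP => U; rewrite !ffunE /GRing.scale /=; ring. Qed.

Lemma ext_mapM x y : ext_map (x * y) = ext_map x * ext_map y.
Proof.
apply/ffunP => U; rewrite ![in LHS]ffunE mulr_sumr [in RHS]ffunE.
rewrite [RHS](reindex (fun S : {set I} => phi @: S)) /=; last first.
  by exists (fun U : {set J} => phi @^-1: U) => ? _; rewrite ?preimK ?imK.
apply: eq_big => [S|S SU]; first by rewrite sub_imset_pre.
rewrite !ffunE preimK preimsetD preimK.
have -> : U :\: phi @: S = phi @: (phi @^-1: U :\: S).
  by rewrite -[LHS]imK preimsetD preimK.
set T := _ :\: S; have dST : [disjoint S & T].
  by rewrite -setI_eq0 setIDA setDIl setDv set0I.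
have UE : phi @^-1: U = S :|: T.
  by rewrite /T setDE setUIr setUCr setIT (setUidPr SU).
have := epsU dST; rewrite -UE => e.
by rewrite mulrA e; ring.
Qed.

Lemma ext_map_base S : ext_map (ext_base K S) = eps S *: ext_base K (phi @: S).
Proof.
apply/ffunP => U; rewrite !ffunE.
have -> : (phi @^-1: U == S) = (U == phi @: S).
  by apply/eqP/eqP => [<-|->]; rewrite ?imK ?preimK.
by case: eqP => [->|_]; rewrite ?preimK ?mulr0 ?scaler0.
Qed.

Lemma ext_map1 : ext_map 1 = 1.
Proof.
rewrite [LHS]ext_map_base imset0 /eps /flips big_set0 expr0 scale1r.
by [].
Qed.

Lemma ext_map_bd S : ext_map (ext_bd K S) = eps S *: ext_bd K (phi @: S).
Proof.
pose g : {linear ext K I -> ext K J} :=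
  HB.pack ext_map (GRing.isLinear.Build K _ _ _ ext_map ext_map_linear).
rewrite -[LHS]/(g _) /ext_bd linear_sum /= big_imset /=; last first.
  by move=> ? ? _ _; apply: phi_inj.
rewrite scaler_sumr; apply: eq_bigr => i iS.
rewrite -[ext_map _]/(g _) linearZ /= [ext_map _]ext_map_base !scalerA.
have d1 : [disjoint [set i] & S :\ i] by rewrite disjoints1 !inE eqxx.
have SE : S = [set i] :|: (S :\ i) by rewrite setD1K.
have im1 : phi @: [set i] = [set phi i] by rewrite imset_set1.
have imD : phi @: (S :\ i) = (phi @: S) :\ phi i.
  by rewrite -[RHS]imK preimsetD preimK -im1 preimK.
have eps1 : eps [set i] = 1.
  by rewrite /eps /flips !big_set1 /flip ltnn expr0.
have inv1 : inversions [set i] S = inversions [set i] (S :\ i).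
  by rewrite {1}SE inversionsUr // inversions_1_1 ltnn.
have inv2 : inversions [set phi i] (phi @: S) =
    inversions [set phi i] (phi @: (S :\ i)).
  rewrite {1}SE imsetU im1 inversionsUr ?inversions_1_1 ?ltnn //.
  by rewrite disjoints1 mem_imset // !inE eqxx.
have := epsU d1; rewrite -SE eps1 mul1r im1 -inv1 -inv2 => e.
rewrite -imD; congr (_ *: _).
set sI := (-1) ^+ _ in e *; set sJ := (-1) ^+ _ in e *.
have -> : sI * eps (S :\ i) = sI * (eps (S :\ i) * sJ) * sJ.
  by rewrite -mulrA -mulrA -expr2 sqrr_sign mulr1.
by rewrite -e mulrCA -expr2 sqrr_sign mulr1.
Qed.

Lemma ext_map_gen_ideal (depI : pred {set I}) (depJ : pred {set J}) x :
  (forall S, depJ (phi @: S) = depI S) ->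
  (ext_map x \in gen_ideal K depJ) = (x \in gen_ideal K depI).
Proof.
move=> depE.
apply/idP/idP => [yI|xI].
  rewrite -(ext_mapK x); move: yI.
  apply: (gen_ideal_map ext_unmap_linear) => T a b.
  rewrite -(imK T) depE => dT; rewrite -(ext_unmapK a) -(ext_unmapK b).
  set S := _ @^-1: _; have -> : ext_bd K (phi @: S) = ext_map (eps S *: ext_bd K S).
    by rewrite ext_mapZ ext_map_bd scalerA eps_sq scale1r.
  rewrite -!ext_mapM ext_mapK -scalerAr -scalerAl memvZ //.
  exact: mem_gen_ideal.
move: xI; apply: (gen_ideal_map ext_map_linear) => S a b dS.
rewrite !ext_mapM ext_map_bd -scalerAr -scalerAl memvZ //.
by apply: mem_gen_ideal; rewrite depE.
Qed.

Lemma ext_map_homog k x : ext_homog k x -> ext_homog k (ext_map x).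
Proof.
move=> hx U Uk; rewrite ffunE hx ?mulr0 //.
by rewrite -(card_imset _ phi_inj) imK.
Qed.

End ExteriorRelabelling.

(** * Relabelling Orlik-Solomon algebras *)

Lemma mem_os_ideal (K F : fieldType) (A : {fset pline F}) (x : ext K A) :
  (x \in os_ideal K A) = (os_pi x == 0 :> os K A).
Proof.
have <- : os_pi 0 = 0 :> os K A.
  by apply: (addrI (os_pi 0)); rewrite -os_piD !addr0.
by rewrite os_pi_eq subr0.
Qed.

Lemma os_pi_mul (K F : fieldType) (A : {fset pline F}) (x y : ext K A) :
  os_pi (x * y) = (os_pi x : os K A) * os_pi y.
Proof. exact: os_piM. Qed.

Section RelabellingArrangements.
Variables (K F : fieldType) (A B : {fset pline F}) (phi : A -> B).
Hypothesis phi_bij : bijective phi.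
Hypothesis phi_dep : forall S : {set A}, os_dependent (phi @: S) = os_dependent S.

Let ideal_map x : (ext_map phi x \in os_ideal K B) = (x \in os_ideal K A).
Proof. exact: ext_map_gen_ideal. Qed.

Definition os_map (u : os K A) : os K B := os_pi (ext_map phi (repr u)).

Let os_ex (C : {fset pline F}) (u : os K C) : exists x, u = os_pi x.
Proof. by exists (repr u); rewrite /os_pi reprK. Qed.

Lemma os_map_pi x : os_map (os_pi x) = os_pi (ext_map phi x).
Proof.
apply/eqP; rewrite /os_map os_pi_eq -scaleN1r addrC -ext_map_linear ideal_map.
by rewrite scaleN1r addrC -os_pi_eq /os_pi reprK.
Qed.

Let os_map_linear : linear os_map.
Proof.
move=> c u v; have [x ->] := os_ex u; have [y ->] := os_ex v.
rewrite -[c *: _]os_piZ -os_piD os_map_pi ext_map_linear os_piD os_piZ.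
by rewrite !os_map_pi.
Qed.

Let os_map_monoid : monoid_morphism os_map.
Proof.
split=> [|u v]; first by rewrite [1]/(os_pi 1) os_map_pi ext_map1.
have [x ->] := os_ex u; have [y ->] := os_ex v.
rewrite -[_ * _]os_piM os_map_pi ext_mapM // os_piM.
by rewrite !os_map_pi.
Qed.

Lemma combinatorially_equivalent_bij : combinatorially_equivalent K A B.
Proof.
pose f : {lrmorphism os K A -> os K B} := HB.pack os_map
  (GRing.isLinear.Build K _ _ _ os_map os_map_linear)
  (GRing.isMonoidMorphism.Build _ _ os_map os_map_monoid).
exists f => [|k u [x hx ->]]; last first.
  by exists (ext_map phi x); [apply: ext_map_homog | apply: os_map_pi].
exists (fun v => os_pi (ext_unmap phi (repr v))) => [u|v].
  have [x ->] := os_ex u; rewrite /= os_map_pi.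
  apply/eqP; rewrite os_pi_eq -ideal_map.
  rewrite -scaleN1r [X in ext_map phi X]addrC ext_map_linear scaleN1r addrC.
  by rewrite ext_unmapK // -os_pi_eq /os_pi reprK.
by rewrite /= os_map_pi ext_unmapK // /os_pi reprK.
Qed.

End RelabellingArrangements.

(** * Incidence and dihedral combinatorics *)

Section Incidence.
Variable F : fieldType.
Implicit Types (P Q : ppoint F) (L M : pline F) (v : 'rV[F]_3).

Lemma dim_point v : v != 0 -> \dim <[v]> == 1%N.
Proof. by move=> v0; rewrite dim_vline v0. Qed.

Definition point_of v (v0 : v != 0) : ppoint F := exist _ <[v]>%VS (dim_point v0).

Lemma point_ofP P : exists v (v0 : v != 0), P = point_of v0.
Proof.
have v0 : vpick (val P) != 0 by rewrite vpick0 -dimv_eq0 (eqP (valP P)).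
exists _, v0; apply/val_inj/esym/eqP => /=.
by rewrite eqEdim -memvE memv_pick (eqP (valP P)) dim_vline v0.
Qed.

Lemma lies_on_point_of v (v0 : v != 0) L : lies_on (point_of v0) L = (v \in val L).
Proof. by rewrite /lies_on /= memvE. Qed.

Lemma dim_join P Q : P != Q -> \dim (val P + val Q) = 2%N.
Proof.
move=> PQ; have := dimv_sum_cap (val P) (val Q).
rewrite (eqP (valP P)) (eqP (valP Q)).
suff -> : \dim (val P :&: val Q) = 0%N by rewrite addn0.
apply/eqP; rewrite -leqn0 -ltnS ltnNge; apply: contra PQ => d1.
have sub (P' Q' : ppoint F) : (1 <= \dim (val P' :&: val Q'))%N ->
    (val P' :&: val Q')%VS = val P'.
  by move=> d; apply/eqP; rewrite eqEdim capvSl (eqP (valP P')).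
by rewrite -val_eqE -[X in X == _](sub P Q) // capvC (sub Q P) // capvC.
Qed.

Lemma line_through P Q L : P != Q -> lies_on P L -> lies_on Q L ->
  val L = (val P + val Q)%VS.
Proof.
move=> PQ PL QL; apply/esym/eqP; rewrite eqEdim (dim_join PQ) (eqP (valP L)).
by rewrite subv_add; apply/andP; split=> //; apply/andP.
Qed.

Lemma line_unique P Q L M : P != Q -> lies_on P L -> lies_on Q L ->
  lies_on P M -> lies_on Q M -> L = M.
Proof.
move=> PQ PL QL PM QM; apply/val_inj.
by rewrite (line_through PQ PL QL) (line_through PQ PM QM).
Qed.

Lemma meet_neq0 L M : (0 < \dim (val L :&: val M))%N.
Proof.
have := dimv_sum_cap (val L) (val M); rewrite (eqP (valP L)) (eqP (valP M)).
by have := dimvS (subvf (val L + val M)); rewrite dimvf /dim /=; lia.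
Qed.

Lemma meet_point L M : exists2 P, lies_on P L & lies_on P M.
Proof.
have v0 : vpick (val L :&: val M) != 0.
  by rewrite vpick0 -dimv_eq0 -lt0n meet_neq0.
exists (point_of v0); rewrite lies_on_point_of.
  exact: (subvP (capvSl _ _) _ (memv_pick _)).
exact: (subvP (capvSr _ _) _ (memv_pick _)).
Qed.

Lemma normal_vector (U : {vspace 'rV[F]_3}) : (\dim U <= 2)%N ->
  exists2 a, a != 0 & (U <= zeros a)%VS.
Proof.
move=> dU; pose B : 'M[F]_(3, \dim U) := \matrix_(i, k) (vbasis U)`_k 0 i.
have k0 : kermx B != 0.
  rewrite -mxrank_eq0 mxrank_ker subn_eq0 -ltnNge.
  by rewrite (leq_ltn_trans (rank_leq_col _)).
exists (nz_row (kermx B)); first by rewrite nz_row_eq0.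
rewrite -{1}(span_basis (vbasisP U)); apply/span_subvP => v vU.
have aB : nz_row (kermx B) *m B = 0 by apply/sub_kermxP; apply: nz_row_sub.
rewrite memv_ker lfunE /= -trmx_eq0 trmx_mul trmxK.
have kU : (index v (vbasis U) < \dim U)%N by rewrite -{2}(size_tuple (vbasis U)) index_mem.
have -> : v^T = col (Ordinal kU) B.
  by apply/colP => i; rewrite !mxE /= nth_index.
by rewrite colE mulmxA aB mul0mx.
Qed.

Lemma line_equation L : exists a (a0 : a != 0), L = line_of a0.
Proof.
have [|a a0 La] := @normal_vector (val L); first by rewrite (eqP (valP L)).
exists a, a0; apply/val_inj/eqP => /=.
by rewrite eqEdim La (eqP (valP L)) (eqP (dim_zeros a0)).
Qed.

Lemma mem_zeros a v : (v \in zeros a) = (v *m a^T == 0).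
Proof. by rewrite memv_ker lfunE. Qed.

Variable A : {fset pline F}.

(** The empty set, a single plane and two distinct planes all have the expected codimension. *)
Lemma os_dependent_gt2 (S : {set A}) : os_dependent S -> (2 < #|S|)%N.
Proof.
rewrite /os_dependent; case: (ltnP 2 #|S|) => // S2 h; exfalso.
move: h S2; case: (posnP #|S|) => [/eqP|].
  by rewrite cards_eq0 => /eqP ->; rewrite big_set0 dimvf cards0.
case: (eqVneq #|S| 1%N) => [/eqP/cards1P[L ->]|S1 S0 h S2].
  by rewrite big_set1 cards1 (eqP (valP (val L))).
have /cards2P[L [M [LM SE]]] : #|S| == 2%N by lia.
have S2' : #|S| = 2%N by rewrite SE cards2 LM.
move: h; rewrite S2'; set U := (\bigcap_(N in S) _)%VS => h.
have sub (N : A) : N \in S -> U = val (val N).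
  move=> NS; apply/eqP; rewrite eqEdim (subv_bigcapP (subvv U) N NS).
  by rewrite (eqP (valP (val N))); move: h; case: (\dim U) => [|[|k]].
case/eqP: LM; apply/val_inj/val_inj.
by rewrite -!sub // SE !inE eqxx ?orbT.
Qed.

Lemma os_dependent3 (S : {set A}) : #|S| = 3%N ->
  reflect (exists P, forall L : A, L \in S -> lies_on P (val L)) (os_dependent S).
Proof.
move=> S3; rewrite /os_dependent S3; set U := (\bigcap_(L in S) _)%VS.
have dE : (3 - \dim U < 3)%N = (U != 0%VS).
  by rewrite -dimv_eq0; have := dimvS (subvf U); rewrite dimvf /dim /=; lia.
rewrite dE; apply: (iffP idP) => [U0|[P PS]].
  have v0 : vpick U != 0 by rewrite vpick0.
  exists (point_of v0) => L LS; rewrite lies_on_point_of.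
  by apply: (subvP (subv_bigcapP (subvv U) L LS)); apply: memv_pick.
rewrite -dimv_eq0 -lt0n (leq_trans _ (dimvS (_ : (val P <= U)%VS))) //.
  by rewrite (eqP (valP P)).
by apply/subv_bigcapP => L /PS.
Qed.

End Incidence.

Section Dihedral.
Variables (n : nat).

(* The combinatorics of the Boroczky arrangement: M i and M j meet on L (i + j),
   and the lines L i are concurrent. *)
Definition dihedral (I : finType) (dep : pred {set I}) (M L : 'I_n.+1 -> I) : Prop :=
  [/\ injective M, injective L, forall i j, M i != L j,
      forall x, (exists i, x = M i) \/ (exists i, x = L i) &
  [/\ forall i j k, i != j -> dep [set M i; M j; L k] = (k == i + j),
      forall i j k, i != j -> i != k -> j != k -> dep [set L i; L j; L k],
      forall i j k, i != j -> ~~ dep [set L i; L j; M k] &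
      forall i j k, i != j -> i != k -> j != k -> ~~ dep [set M i; M j; M k]]].

Lemma set3_swap12 (T : finType) (a b c : T) : [set a; b; c] = [set b; a; c].
Proof. by rewrite [[set a; b]]setUC. Qed.

Lemma set3_swap23 (T : finType) (a b c : T) : [set a; b; c] = [set a; c; b].
Proof. by rewrite setUAC. Qed.

Lemma cards3 (T : finType) (a b c : T) :
  a != b -> a != c -> b != c -> #|[set a; b; c]| = 3%N.
Proof.
by move=> ab ac bc; rewrite setUC cardsU1 cards2 !inE negb_or ![c == _]eq_sym ac bc ab.
Qed.

Lemma in_set3P (T : finType) (P : T -> Prop) (a b c : T) :
  (forall x, x \in [set a; b; c] -> P x) <-> [/\ P a, P b & P c].
Proof.
split=> [h|[pa pb pc] x]; first by split; apply: h; rewrite !inE eqxx ?orbT.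
by rewrite !inE => /orP[/orP[]|] /eqP ->.
Qed.

Lemma cards3P (T : finType) (S : {set T}) : #|S| = 3%N ->
  exists a b c, [/\ a != b, a != c, b != c & S = [set a; b; c]].
Proof.
move=> S3; have /card_gt0P[a aS] : (0 < #|S|)%N by rewrite S3.
have /cards2P[b [c [bc SE]]] : #|S :\ a| == 2%N.
  by have := cardsD1 a S; rewrite aS S3 => /eqP; rewrite add1n eqSS eq_sym.
have ab x : x \in S :\ a -> a != x by rewrite !inE eq_sym => /andP[].
exists a, b, c; split=> //; first by apply: ab; rewrite SE !inE eqxx.
  by apply: ab; rewrite SE !inE eqxx orbT.
by rewrite -setUA -SE setD1K.
Qed.

Section Bijection.
Variables (I J : finType) (dep : pred {set I}) (dep' : pred {set J}).
Variables (M L : 'I_n.+1 -> I) (M' L' : 'I_n.+1 -> J).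
Hypotheses (dih : dihedral dep M L) (dih' : dihedral dep' M' L').

(** The default [M' 0] is never reached, because the two families cover [I]. *)
Definition dihedral_map (x : I) : J :=
  if [pick i | x == M i] is Some i then M' i else
  if [pick i | x == L i] is Some i then L' i else M' 0.

Lemma dihedral_mapM i : dihedral_map (M i) = M' i.
Proof.
have [M_inj _ _ _ _] := dih; rewrite /dihedral_map.
by case: pickP => [j /eqP/M_inj-> //|/(_ i)]; rewrite eqxx.
Qed.

Lemma dihedral_mapL i : dihedral_map (L i) = L' i.
Proof.
have [_ L_inj ML _ _] := dih; rewrite /dihedral_map.
case: pickP => [j /eqP e|_]; first by have := ML j i; rewrite e eqxx.
by case: pickP => [j /eqP/L_inj-> //|/(_ i)]; rewrite eqxx.
Qed.

End Bijection.

(** Dependence is decided by size except for triples, and [dihedral] decides each kind of triple by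
    its indices. *)
Lemma dihedral_equivalent (I J : finType) (dep : pred {set I}) (dep' : pred {set J})
    (M L : 'I_n.+1 -> I) (M' L' : 'I_n.+1 -> J) :
  dihedral dep M L -> dihedral dep' M' L' ->
  (forall S, dep S -> (2 < #|S|)%N) ->
  (forall S : {set I}, (3 < #|S|)%N -> dep S) ->
  (forall S, dep' S -> (2 < #|S|)%N) ->
  (forall S : {set J}, (3 < #|S|)%N -> dep' S) ->
  exists2 phi : I -> J, bijective phi & forall S : {set I}, dep' (phi @: S) = dep S.
Proof.
move=> dih dih' lo hi lo' hi'; pose phi := dihedral_map M L M' L'.
have phiM i : phi (M i) = M' i by apply: dihedral_mapM dih _.
have phiL i : phi (L i) = L' i by apply: dihedral_mapL dih _.
have [M_inj L_inj ML cov [dMML dLLL dLLM dMMM]] := dih.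
have [M'_inj L'_inj ML' cov' [dMML' dLLL' dLLM' dMMM']] := dih'.
have phi_bij : bijective phi.
  exists (dihedral_map M' L' M L) => x.
    by case: (cov x) => [] [i ->]; rewrite ?phiM ?phiL
      ?(dihedral_mapM _ _ dih') ?(dihedral_mapL _ _ dih').
  by case: (cov' x) => [] [i ->]; rewrite ?(dihedral_mapM _ _ dih')
    ?(dihedral_mapL _ _ dih') ?phiM ?phiL.
exists phi => // S; have cS := card_imset S (bij_inj phi_bij).
case: (ltngtP #|S| 3%N) => [S2|S3|/cards3P[a [b [c [ab ac bc ->]]]]].
- have /negPf -> : ~~ dep S by apply/negP => /lo; lia.
  by apply/negP => /lo'; lia.
- by rewrite hi // hi' // cS.
rewrite !imsetU !imset_set1 {S cS}.
move: ab ac bc.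
have eM i j : M i != M j -> i != j by rewrite (inj_eq M_inj).
have eL i j : L i != L j -> i != j by rewrite (inj_eq L_inj).
have MMM i j k : M i != M j -> M i != M k -> M j != M k ->
    dep' [set M' i; M' j; M' k] = dep [set M i; M j; M k].
  by move=> /eM ij /eM ik /eM jk; rewrite (negPf (dMMM' _ _ _ ij ik jk))
    (negPf (dMMM _ _ _ ij ik jk)).
have MML i j k : M i != M j ->
    dep' [set M' i; M' j; L' k] = dep [set M i; M j; L k].
  by move=> /eM ij; rewrite dMML // dMML'.
have LLM i j k : L i != L j ->
    dep' [set L' i; L' j; M' k] = dep [set L i; L j; M k].
  by move=> /eL ij; rewrite (negPf (dLLM' _ _ _ ij)) (negPf (dLLM _ _ _ ij)).
have LLL i j k : L i != L j -> L i != L k -> L j != L k ->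
    dep' [set L' i; L' j; L' k] = dep [set L i; L j; L k].
  by move=> /eL ij /eL ik /eL jk; rewrite dLLL // dLLL'.
case: (cov a) => [] [i ->]; case: (cov b) => [] [j ->];
  case: (cov c) => [] [k ->]; rewrite ?phiM ?phiL => ab ac bc.
- exact: MMM.
- exact: MML.
- by rewrite set3_swap23 MML // set3_swap23.
- by rewrite set3_swap12 set3_swap23 LLM // set3_swap23 set3_swap12.
- by rewrite set3_swap12 set3_swap23 MML // set3_swap23 set3_swap12.
- by rewrite set3_swap23 LLM // set3_swap23.
- exact: LLM.
- exact: LLL.
Qed.

(** A point of some M_i lies off [P], hence on at most one of the L's. So the meeting rule
    determines all triples; three concurrent M's would give i + j = i + k. *)
Lemma dihedral_of_incidence (F : fieldType) (A : {fset pline F}) (P : ppoint F)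
    (M L : 'I_n.+1 -> A) :
  injective M -> injective L ->
  (forall x, (exists i, x = M i) \/ (exists i, x = L i)) ->
  (forall i, lies_on P (val (L i))) -> (forall i, ~~ lies_on P (val (M i))) ->
  (forall i j, i != j -> exists Q,
     [/\ lies_on Q (val (M i)), lies_on Q (val (M j)) & lies_on Q (val (L (i + j)))]) ->
  dihedral (@os_dependent F A) M L.
Proof.
move=> M_inj L_inj cov PL PM meet.
have ML i j : M i != L j.
  by apply: contraNneq (PM i) => ->; apply: PL.
have card3 (a b c : A) : a != b -> a != c -> b != c -> #|[set a; b; c]| = 3%N.
  exact: cards3.
have dep3 (a b c : A) : a != b -> a != c -> b != c ->
  reflect (exists Q, [/\ lies_on Q (val a), lies_on Q (val b) & lies_on Q (val c)])
          (os_dependent [set a; b; c]).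
  move=> ab ac bc; apply: (iffP (os_dependent3 (card3 _ _ _ ab ac bc))).
    by case=> Q /in_set3P h; exists Q.
  by case=> Q h; exists Q; apply/in_set3P.
have offP Q i : lies_on Q (val (M i)) -> P != Q.
  by move=> h; apply: contraNneq (PM i) => ->.
have LE Q i j k : lies_on Q (val (M k)) -> lies_on Q (val (L i)) ->
    lies_on Q (val (L j)) -> i = j.
  move=> /offP PQ Qi Qj; apply/L_inj/val_inj.
  exact: (line_unique PQ).
have meetE i j Q : i != j -> lies_on Q (val (M i)) -> lies_on Q (val (M j)) ->
    lies_on Q (val (L (i + j))).
  move=> ij Qi Qj; have [Q' [Q'i Q'j Q'L]] := meet _ _ ij.
  have [-> //|QQ'] := eqVneq Q Q'; case/eqP: ij.
  exact/M_inj/val_inj/(line_unique QQ').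
split=> //; split.
- move=> i j k ij.
  have Mij : M i != M j by rewrite (inj_eq M_inj).
  apply/(dep3 _ _ _ Mij (ML _ _) (ML _ _))/eqP => [[Q [Qi Qj Qk]]|->].
    exact: LE Qi Qk (meetE _ _ _ ij Qi Qj).
  exact: meet.
- move=> i j k ij ik jk; apply/dep3; rewrite ?(inj_eq L_inj) //.
  by exists P; split.
- move=> i j k ij; have Lij : L i != L j by rewrite (inj_eq L_inj).
  apply/(dep3 _ _ _ Lij); rewrite 1?eq_sym //; case=> Q [Qi Qj Qk].
  by case/eqP: ij; apply: LE Qk Qi Qj.
- move=> i j k ij ik jk.
  apply/dep3; rewrite ?(inj_eq M_inj) //; case=> Q [Qi Qj Qk].
  case/eqP: jk; apply: (@addrI _ i); exact: LE (Qi) (meetE _ _ _ ij Qi Qj) (meetE _ _ _ ik Qi Qk).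
Qed.

End Dihedral.

(** * Isotropic triples of a dihedral arrangement *)

Lemma proportional_rows (K : fieldType) (r : nat) (z v : 'rV[K]_r) :
  (forall a b, z 0 a * v 0 b = z 0 b * v 0 a) -> z = 0 \/ exists c, v = c *: z.
Proof.
move=> h; have [/existsP[a za]|/existsPn no] := boolP [exists a, z 0 a != 0].
  right; exists (v 0 a / z 0 a); apply/rowP => b; rewrite mxE mulrAC -[v 0 a * _]mulrC.
  by rewrite -h mulrAC divff // mul1r.
by left; apply/rowP => a; rewrite mxE; apply/eqP; rewrite -[_ == _]negbK no.
Qed.

Section DihedralResonance.
Variables (K : fieldType) (n : nat) (I : finType) (dep : pred {set I}).
Variables M L : 'I_n.+1 -> I.
Hypothesis charK : [pchar K] =i pred0.
Hypothesis dih : dihedral dep M L.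
Hypothesis dep_gt2 : forall S, dep S -> (2 < #|S|)%N.

(** The lemmas from here to [flatL] show that {M_i, M_j, L_(i+j)}, {M_i, L_(2i)} and the set of all
    L's are flats, as [gen_ideal_local] requires. *)
Let flatMM i j r : i != j -> dep [set M i; M j; r] ->
  r \in [set M i; M j; L (i + j)].
Proof.
have [M_inj L_inj ML cov [dMML dLLL dLLM dMMM]] := dih.
move=> ij; case: (cov r) => [] [k ->]; rewrite !inE.
  case: (eqVneq i k) => [->|ik]; first by rewrite eqxx.
  case: (eqVneq j k) => [->|jk]; first by rewrite eqxx orbT.
  by rewrite (negPf (dMMM _ _ _ ij ik jk)).
by rewrite dMML // => /eqP ->; rewrite eqxx orbT.
Qed.

Let flatML i k r : dep [set M i; L k; r] -> r \in [set M i; M (k - i); L k].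
Proof.
have [M_inj L_inj ML cov [dMML dLLL dLLM dMMM]] := dih.
case: (cov r) => [] [j ->]; rewrite !inE.
  case: (eqVneq i j) => [->|ij]; first by rewrite eqxx.
  rewrite set3_swap23 dMML // => /eqP ->.
  by rewrite [i + j]addrC addrK eqxx orbT.
case: (eqVneq k j) => [->|kj]; first by rewrite eqxx orbT.
by rewrite set3_swap12 set3_swap23 (negPf (dLLM _ _ _ kj)).
Qed.

Let flatLL i j r : i != j -> dep [set L i; L j; r] -> r \in [set L k | k in predT].
Proof.
have [M_inj L_inj ML cov [dMML dLLL dLLM dMMM]] := dih.
move=> ij; case: (cov r) => [] [k ->]; last by rewrite imset_f.
by rewrite (negPf (dLLM _ _ _ ij)).
Qed.

Let flat3 i j : i != j -> forall p q r,
  p \in [set M i; M j; L (i + j)] -> q \in [set M i; M j; L (i + j)] -> p != q ->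
  dep [set p; q; r] -> r \in [set M i; M j; L (i + j)].
Proof.
move=> ij p q r; rewrite 2![_ \in [set _; _; _]]inE ![_ \in [set _; _]]inE.
rewrite ![_ \in [set _]]inE.
have h1 r' : dep [set M i; L (i + j); r'] -> r' \in [set M i; M j; L (i + j)].
  by move/flatML; rewrite [i + j]addrC addrK.
have h2 r' : dep [set M j; L (i + j); r'] -> r' \in [set M i; M j; L (i + j)].
  by move/flatML; rewrite addrK set3_swap12.
move=> /orP[/orP[]|] /eqP -> /orP[/orP[]|] /eqP ->; rewrite ?eqxx // => _.
- exact: flatMM.
- exact: h1.
- by rewrite set3_swap12; apply: flatMM.
- exact: h2.
- by rewrite set3_swap12; apply: h1.
- by rewrite set3_swap12; apply: h2.
Qed.

Let flat2 i : forall p q r,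
  p \in [set M i; L (i + i)] -> q \in [set M i; L (i + i)] -> p != q ->
  dep [set p; q; r] -> r \in [set M i; L (i + i)].
Proof.
move=> p q r; rewrite !inE.
have h1 r' : dep [set M i; L (i + i); r'] -> (r' == M i) || (r' == L (i + i)).
  by move/flatML; rewrite addrK !inE orbb.
move=> /orP[] /eqP -> /orP[] /eqP ->; rewrite ?eqxx // => _; first exact: h1.
by rewrite set3_swap12; apply: h1.
Qed.

Let flatL : forall p q r,
  p \in [set L k | k in predT] -> q \in [set L k | k in predT] -> p != q ->
  dep [set p; q; r] -> r \in [set L k | k in predT].
Proof.
have [_ L_inj _ _ _] := dih.
move=> p q r /imsetP[i _ ->] /imsetP[j _ ->]; rewrite (inj_eq L_inj).
exact: flatLL.
Qed.

Variable x : 'I_3 -> ext K I.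
Hypothesis x1 : forall a, ext_homog 1 (x a).
Hypothesis xx : forall a b, a != b -> x a * x b \in gen_ideal K dep.
Hypothesis x_free : forall c : 'I_3 -> K, \sum_a c a *: x a = 0 -> forall a, c a = 0.

Let u i : 'rV[K]_3 := \row_a ext_coef (x a) (M i).
Let l i : 'rV[K]_3 := \row_a ext_coef (x a) (L i).

Let local (T : {set I}) (z : 'rV[K]_3) (p : I) :
  (forall i j k, i \in T -> j \in T -> i != j -> dep [set i; j; k] -> k \in T) ->
  p \in T -> z = \row_a \sum_(q in T) ext_coef (x a) q ->
  z = 0 \/ exists c, \row_a ext_coef (x a) p = c *: z.
Proof.
move=> fT pT ->; apply: proportional_rows => a b; rewrite !mxE.
have [->//|ab] := eqVneq a b.
exact: (gen_ideal_local dep_gt2 fT (x1 a) (x1 b) (xx ab) pT).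
Qed.

Let uul i j : i != j -> let z := u i + u j + l (i + j) in
  [/\ z = 0 \/ exists c, u i = c *: z, z = 0 \/ exists c, u j = c *: z &
      z = 0 \/ exists c, l (i + j) = c *: z].
Proof.
have [M_inj L_inj ML _ _] := dih; move=> ij z.
have zE : z = \row_a \sum_(q in [set M i; M j; L (i + j)]) ext_coef (x a) q.
  apply/rowP => a; rewrite !mxE setUC big_setU1 /=; last first.
    by rewrite !inE negb_or ![L _ == _]eq_sym !ML.
  by rewrite big_setU1 /= ?big_set1 ?inE ?(inj_eq M_inj) // addrC addrA.
by split; apply: local (flat3 ij) _ zE; rewrite !inE eqxx ?orbT.
Qed.

Let ul i : let z := u i + l (i + i) in
  (z = 0 \/ exists c, u i = c *: z) /\ (z = 0 \/ exists c, l (i + i) = c *: z).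
Proof.
have [M_inj L_inj ML _ _] := dih; move=> z.
have zE : z = \row_a \sum_(q in [set M i; L (i + i)]) ext_coef (x a) q.
  by apply/rowP => a; rewrite !mxE big_setU1 /= ?big_set1 // inE ML.
by split; apply: local (flat2 (i := i)) _ zE; rewrite !inE eqxx ?orbT.
Qed.

Let ll : let z := \sum_i l i in forall i, z = 0 \/ exists c, l i = c *: z.
Proof.
have [_ L_inj _ _ _] := dih; move=> z i.
have zE : z = \row_a \sum_(q in [set L k | k in predT]) ext_coef (x a) q.
  apply/rowP => a; rewrite /z summxE mxE big_imset /=; last by move=> ? ? _ _ /L_inj.
  by apply: eq_bigr => k _; rewrite mxE.
by apply: local flatL _ zE; rewrite imset_f.
Qed.

Let coef0 (y : ext K I) : ext_homog 1 y -> (forall i, ext_coef y (M i) = 0) ->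
  (forall i, ext_coef y (L i) = 0) -> y = 0.
Proof.
have [_ _ _ cov _] := dih; move=> y1 yM yL; rewrite (ext_homog1E y1) big1 // => p _.
by case: (cov p) => [] [i ->]; rewrite ?yM ?yL scale0r.
Qed.

(** A vector normal to all coefficient vectors is a linear relation among the three elements
    [x a]. *)
Let full (U : {vspace 'rV[K]_3}) :
  (forall i, u i \in U) -> (forall i, l i \in U) -> (2 < \dim U)%N.
Proof.
move=> uU lU; rewrite ltnNge; apply/negP => /normal_vector[a a0 /subvP aU].
have c0 p v : v = \row_k ext_coef (x k) p -> v \in U ->
    \sum_k a 0 k * ext_coef (x k) p = 0.
  move=> -> /aU; rewrite mem_zeros => /eqP/matrixP/(_ 0 0); rewrite !mxE => e.
  by rewrite -[RHS]e; apply: eq_bigr => k _; rewrite !mxE mulrC.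
have sE p : ext_coef (\sum_k a 0 k *: x k) p = \sum_k a 0 k * ext_coef (x k) p.
  by rewrite /ext_coef sum_ffunE; apply: eq_bigr => k _; rewrite ffunE.
case/eqP: a0; apply/rowP => k; rewrite mxE; apply: (x_free (c := a 0)).
apply: coef0 => [|i|i]; rewrite ?sE; last 2 first.
- exact: c0 (erefl _) (uU i).
- exact: c0 (erefl _) (lU i).
move=> S S1; rewrite sum_ffunE big1 // => b _.
by rewrite ffunE (x1 b) // scaler0.
Qed.

Lemma dihedral_isotropic a :
  (forall i, ext_coef (x a) (M i) = 0) /\ \sum_i ext_coef (x a) (L i) = 0.
Proof.
have [u0 l0] := isotropic_pencil charK uul ul ll full; split=> [i|].
  by have /rowP/(_ a) := u0 i; rewrite !mxE.
move/rowP/(_ a): l0; rewrite summxE mxE => e.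
by rewrite -[RHS]e; apply: eq_bigr => i _; rewrite mxE.
Qed.

End DihedralResonance.

Lemma dihedral_isotropic_mul (K : fieldType) (n : nat) (I : finType)
    (dep : pred {set I}) (M L : 'I_n.+1 -> I) (y z : ext K I) :
  dihedral dep M L -> ext_homog 1 y -> ext_homog 1 z ->
  (forall i, ext_coef y (M i) = 0) /\ \sum_i ext_coef y (L i) = 0 ->
  (forall i, ext_coef z (M i) = 0) /\ \sum_i ext_coef z (L i) = 0 ->
  y * z \in gen_ideal K dep.
Proof.
move=> [M_inj L_inj ML cov [dMML dLLL dLLM dMMM]] y1 z1 [yM yL] [zM zL].
have out p : p \notin [set L k | k in predT] -> exists i, p = M i.
  by case: (cov p) => [] [i ->]; [exists i | rewrite imset_f].
have total w : (forall i, ext_coef w (M i) = 0) -> \sum_i ext_coef w (L i) = 0 ->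
    \sum_p ext_coef w p = 0 :> K.
  move=> wM wL; rewrite (bigID [in [set L k | k in predT]]) /= [X in _ + X]big1.
    by rewrite addr0 big_imset //= => ? ? _ _ /L_inj.
  by move=> p /out[i ->].
apply: (gen_ideal_pencil (T := [set L k | k in predT])) => //.
- move=> p q r /imsetP[i _ ->] /imsetP[j _ ->] /imsetP[k _ ->].
  by rewrite !(inj_eq L_inj); apply: dLLL.
- by move=> p /out[i ->].
- by move=> p /out[i ->].
- exact: total.
- exact: total.
Qed.

(** A basis of a three-dimensional space of degree one elements with pairwise zero products modulo
    the ideal; squares of degree one elements vanish in the exterior algebra itself. *)
Definition isotropic_triple (K : fieldType) (I : finType) (dep : pred {set I})
    (x : 'I_3 -> ext K I) : Prop :=
  [/\ forall a, ext_homog 1 (x a),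
      forall a b, a != b -> x a * x b \in gen_ideal K dep &
      forall c : 'I_3 -> K, \sum_a c a *: x a = 0 -> forall a, c a = 0].

(** Lifting to the exterior algebra keeps independence because the ideal is zero in degree one. *)
Lemma isotropic_triple_image (K F : fieldType) (A B : {fset pline F})
    (f : {lrmorphism os K A -> os K B}) (x : 'I_3 -> ext K A) :
  injective f -> (forall k u, os_homog k u -> os_homog k (f u)) ->
  isotropic_triple (@os_dependent F A) x ->
  exists2 x' : 'I_3 -> ext K B, isotropic_triple (@os_dependent F B) x' &
    forall a, f (os_pi (x a)) = os_pi (x' a).
Proof.
move=> f_inj fhom [x1 xx x_free].
have /fin_all_exists2[x' x'1 x'E] : forall a, exists2 y, ext_homog 1 y &
    f (os_pi (x a)) = os_pi y.
  by move=> a; apply: fhom; exists (x a).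
exists x' => //; split=> // [a b ab|c c0].
  rewrite -[_ \in _]/(_ \in os_ideal K B) mem_os_ideal os_pi_mul.
  rewrite -!x'E -rmorphM -os_pi_mul.
  by have := xx a b ab; rewrite -[_ \in _]/(_ \in os_ideal K A) mem_os_ideal => /eqP ->;
    rewrite rmorph0.
apply: x_free; apply: (gen_ideal_homog1 (@os_dependent_gt2 F A)).
  move=> S S1; rewrite sum_ffunE big1 // => b _.
  by rewrite ffunE (x1 b) // scaler0.
rewrite -[_ \in _]/(_ \in os_ideal K A) mem_os_ideal -(inj_eq f_inj) rmorph0.
have piS (C : {fset pline F}) (y : 'I_3 -> ext K C) :
    os_pi (\sum_a c a *: y a) = \sum_a c a *: (os_pi (y a) : os K C).
  rewrite !big_ord_recl !big_ord0 !os_piD !os_piZ.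
  by congr (_ + (_ + (_ + _))); apply/eqP; rewrite -mem_os_ideal mem0v.
rewrite piS linear_sum /=.
have -> : \sum_a f (c a *: os_pi (x a)) = \sum_a c a *: (os_pi (x' a) : os K B).
  by apply: eq_bigr => a _; rewrite linearZ /= x'E.
by rewrite -piS c0 -mem_os_ideal mem0v.
Qed.

(** Both triples are carried into the single pencil of the L's in [B], where all products vanish;
    injectivity brings this back to [A]. *)
Lemma resonance_unique_pencil (K F : fieldType) (A B : {fset pline F}) (n : nat)
    (M L : 'I_n.+1 -> B) (x y : 'I_3 -> ext K A) (a b : 'I_3) :
  [pchar K] =i pred0 -> dihedral (@os_dependent F B) M L ->
  combinatorially_equivalent K A B ->
  isotropic_triple (@os_dependent F A) x -> isotropic_triple (@os_dependent F A) y ->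
  x a * y b \in os_ideal K A.
Proof.
move=> charK dih [f /bij_inj f_inj fhom] tx ty.
have [x' [x'1 x'x' x'_free] x'E] := isotropic_triple_image f_inj fhom tx.
have [y' [y'1 y'y' y'_free] y'E] := isotropic_triple_image f_inj fhom ty.
have px := dihedral_isotropic charK dih (@os_dependent_gt2 F B) x'1 x'x' x'_free a.
have py := dihedral_isotropic charK dih (@os_dependent_gt2 F B) y'1 y'y' y'_free b.
have := dihedral_isotropic_mul dih (x'1 a) (y'1 b) px py.
rewrite -[_ \in _]/(_ \in os_ideal K B) !mem_os_ideal !os_pi_mul -x'E -y'E.
rewrite -rmorphM => /eqP e.
by apply/eqP; apply: f_inj; rewrite rmorph0.
Qed.

(** * The Boroczky arrangement *)

Lemma mem_zeros_row3 (R : realType) (x y z a b c : R) :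
  (row3 x y z \in zeros (row3 a b c)) = (x * a + y * b + z * c == 0).
Proof.
rewrite mem_zeros; set M := _ *m _.
have ME : M 0 0 = x * a + y * b + z * c.
  by rewrite mxE !big_ord_recl big_ord0 !mxE /= addr0 addrA.
apply/eqP/eqP => [M0|e]; first by rewrite -ME M0 mxE.
by apply/matrixP => i j; rewrite !ord1 ME e mxE.
Qed.

Section BoroczkyDihedral.
Variables (R : realType) (n : nat).
Local Notation m := n.+1.
Let ang (i : nat) : R := pi * i%:R / m%:R.

Let ang2 (i : nat) : 2 * pi * i%:R / m%:R = ang i + ang i :> R.
Proof. by rewrite /ang; ring. Qed.

Let sin_ang_inj (i j : nat) : (i < m)%N -> (j < m)%N ->
  sin (ang i - ang j) = 0 -> i = j.
Proof.
wlog ij : i j / (j <= i)%N.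
  move=> H im jm h; case: (leqP j i) => ij; first exact: H.
  by apply/esym/H => //; [exact: ltnW | rewrite -opprB sinN h oppr0].
move=> im jm h; apply/eqP; rewrite eqn_leq ij andbT leqNgt; apply/negP => ji.
have : 0 < sin (ang i - ang j).
  apply: sin_gt0_pi.
  have -> : ang i - ang j = pi * ((i - j)%:R / m%:R).
    by rewrite /ang natrB //; ring.
  rewrite mulr_gt0 ?pi_gt0 ?divr_gt0 ?ltr0n ?subn_gt0 //=.
  rewrite gtr_pMr ?pi_gt0 // ltr_pdivrMr ?ltr0n // mul1r ltr_nat.
  by lia.
by rewrite h ltxx.
Qed.

(** Reducing [i + j] modulo [m] changes the angle by 0 or by pi. *)
Let sin_ang_mod (i j : nat) : (i < m)%N -> (j < m)%N ->
  sin (ang ((i + j) %% m) - (ang i + ang j)) = 0.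
Proof.
move=> im jm; have [ij|ij] := ltnP (i + j) m.
  rewrite modn_small //.
  have -> : ang (i + j) - (ang i + ang j) = 0 by rewrite /ang natrD; ring.
  exact: sin0.
have -> : ((i + j) %% m = i + j - m)%N.
  by rewrite -[in LHS](subnK ij) modnDr modn_small //; lia.
have -> : ang (i + j - m) - (ang i + ang j) = - pi.
  by rewrite /ang natrB // natrD; field; rewrite nat1r.
by rewrite sinN sinpi oppr0.
Qed.

Let B := boroczky R m.

Let memM (i : 'I_m) : boroczkyL R m i \in B.
Proof.
rewrite in_fsetU; apply/orP; left; apply/imfsetP; exists (i : nat) => //.
by change (is_true (nat_of_ord i \in iota 0 m)); rewrite mem_iota ltn_ord.
Qed.

Let memL (i : 'I_m) : boroczkyL' R m i \in B.
Proof.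
rewrite in_fsetU; apply/orP; right; apply/imfsetP; exists (i : nat) => //.
by change (is_true (nat_of_ord i \in iota 0 m)); rewrite mem_iota ltn_ord.
Qed.

(** The names follow [dihedral]: the lines [boroczkyL] play the M's and the lines [boroczkyL'], all
    through [0, 0, 1], play the L's. *)
Definition boroczkyM (i : 'I_m) : B := FSetSub (memM i).
Definition boroczkyP (i : 'I_m) : B := FSetSub (memL i).

Let M_inj : injective boroczkyM.
Proof.
move=> i j /(congr1 val) /= ij.
suff h : sin (ang i - ang j) = 0.
  exact/val_inj/(sin_ang_inj (ltn_ord i) (ltn_ord j) h).
have zE := congr1 (fun L : pline R => val L) ij; rewrite /= in zE.
move: zE; rewrite !ang2; set s := ang i; set t := ang j => zE.
have : row3 1 0 (- cos (s + s)) \in zeros (row3 (cos (s + s)) (sin (s + s)) 1).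
  by rewrite mem_zeros_row3; apply/eqP; ring.
rewrite zE mem_zeros_row3 mul1r mul0r addr0 mulr1 subr_eq0 => /eqP ec.
have : row3 0 1 (- sin (s + s)) \in zeros (row3 (cos (s + s)) (sin (s + s)) 1).
  by rewrite mem_zeros_row3; apply/eqP; ring.
rewrite zE mem_zeros_row3 mul1r mul0r add0r mulr1 subr_eq0 => /eqP es.
(* The equations agree, so the doubled angles have equal cosine and sine; the cosine of twice s - t
   is then 1, which forces sin (s - t) = 0. *)
have c1 : cos ((s - t) + (s - t)) = 1.
  have -> : s - t + (s - t) = (s + s) - (t + t) by ring.
  by rewrite cosB -ec -es -!expr2 ec es cos2Dsin2.
have := cos2Dsin2 (s - t); move: c1; rewrite cosD -!expr2 => c1 c2.
apply/eqP; rewrite -/s -/t -sqrf_eq0; apply/eqP.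
by lra.
Qed.

Let L_inj : injective boroczkyP.
Proof.
move=> i j /(congr1 val) /= ij.
suff h : sin (ang i - ang j) = 0.
  exact/val_inj/(sin_ang_inj (ltn_ord i) (ltn_ord j) h).
have zE : zeros (row3 (sin (ang i)) (- cos (ang i)) 0)
        = zeros (row3 (sin (ang j)) (- cos (ang j)) 0).
  exact: (congr1 val ij).
have : row3 (cos (ang j)) (sin (ang j)) 0 \in
    zeros (row3 (sin (ang j)) (- cos (ang j)) 0).
  by rewrite mem_zeros_row3; apply/eqP; ring.
rewrite -zE mem_zeros_row3 => /eqP e; rewrite sinB -[RHS]e.
by ring.
Qed.

Let center_neq0 : row3 0 0 1 != 0 :> 'rV[R]_3.
Proof. by apply/eqP => /rowP/(_ ord_max)/eqP; rewrite !mxE /= oner_eq0. Qed.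

Lemma boroczky_dihedral : dihedral (@os_dependent R B) boroczkyM boroczkyP.
Proof.
apply: (dihedral_of_incidence (P := point_of center_neq0) M_inj L_inj).
- move=> [x xB]; have := xB; rewrite in_fsetU => /orP[] /imfsetP[i iI xE];
    have im : (i < m)%N by [have : i \in iota 0 m := iI; rewrite mem_iota].
    by left; exists (Ordinal im); apply/val_inj.
  by right; exists (Ordinal im); apply/val_inj.
- move=> i; rewrite lies_on_point_of /= mem_zeros_row3.
  by apply/eqP; ring.
- move=> i; rewrite lies_on_point_of /= mem_zeros_row3 !mul0r !add0r mulr1.
  exact: oner_neq0.
move=> i j ij; set s := ang i; set t := ang j.
(* This is the cross product of (cos 2s, sin 2s, 1) and (cos 2t, sin 2t, 1), divided by 2 sin (s -
   t). *)
have q0 : row3 (cos (s + t)) (sin (s + t)) (- cos (s - t)) != 0.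
  apply/eqP => /rowP q; move: (q ord0) (q (inord 1)).
  rewrite !mxE inordK //= => c0 s0.
  by have /eqP := cos2Dsin2 (s + t); rewrite c0 s0 expr0n addr0 eq_sym oner_eq0.
exists (point_of q0); split; rewrite lies_on_point_of /= mem_zeros_row3 ?ang2 -/s -/t.
- apply/eqP; have -> : s - t = (s + s) - (s + t) by ring.
  by rewrite cosB; ring.
- apply/eqP; have -> : s - t = - ((t + t) - (s + t)) by ring.
  by rewrite cosN cosB; ring.
have := sin_ang_mod (ltn_ord i) (ltn_ord j); rewrite -/s -/t sinB => e.
apply/eqP; rewrite -[RHS]e /ang; ring.
Qed.

End BoroczkyDihedral.

(** * Coordinates *)

(** On the curve (1, t, t^2) each line cuts out the roots of a nonzero polynomial; the product of
    these polynomials is nonzero at some natural number. *)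
Lemma line_avoid (R : realType) (k : nat) (b : 'I_k -> 'rV[R]_3) :
  (forall i, b i != 0) -> exists w, forall i, w \notin zeros (b i).
Proof.
move=> b0; pose q i : {poly R} := \poly_(j < 3) b i 0 (inord j).
have q0 i : q i != 0.
  apply: contra (b0 i) => /eqP qi; apply/eqP/rowP => j; rewrite mxE.
  by have := coef_poly 3 (fun j => b i 0 (inord j)) j; rewrite -/(q i) qi coef0
    ltn_ord inord_val.
pose Q := \prod_i q i; have Q0 : Q != 0 by apply/prodf_neq0 => i _.
have [t Qt] : exists t, ~~ root Q t.
  have : ~~ all (root Q) [seq i%:R | i <- iota 0 (size Q)].
    apply/negP => al; have := max_poly_roots Q0 al.
    rewrite size_map size_iota ltnn => h; suff: false by []; apply: h.
    rewrite map_inj_in_uniq ?iota_uniq // => i j _ _ /eqP.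
    by rewrite eqr_nat => /eqP.
  by case/allPn => t _ Qt; exists t.
exists (\row_j t ^+ j) => i; apply: contra Qt; rewrite mem_zeros => /eqP/matrixP/(_ 0 0).
rewrite !mxE => e; rewrite /root horner_prod (bigD1 i) //= mulf_eq0 horner_poly.
apply/orP; left; rewrite -[X in _ == X]e; apply/eqP/eq_bigr => j _.
by rewrite !mxE inord_val mulrC.
Qed.

Section LineCoordinates.
Variables (R : realType) (n : nat) (p : 'rV[R]_3).
Hypothesis p0 : p != 0.
Variables a b : 'I_n.+1 -> 'rV[R]_3.
Hypotheses (a0 : forall i, a i != 0) (b0 : forall i, b i != 0).
Let M i := line_of (a0 i).
Let L i := line_of (b0 i).
Let P := point_of p0.
Hypotheses (M_inj : injective M) (L_inj : injective L).
Hypotheses (PL : forall i, lies_on P (L i)) (PM : forall i, ~~ lies_on P (M i)).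
Hypothesis n1 : (1 < n)%N.
Hypothesis MM : forall i j, i != j -> exists k Q,
  [/\ lies_on Q (M i), lies_on Q (M j) & lies_on Q (L k)].
Hypothesis MMM : forall i j k Q, i != j -> j != k -> i != k ->
  lies_on Q (M i) -> lies_on Q (M j) -> lies_on Q (M k) -> False.

Let ev (c v : 'rV[R]_3) : R := (v *m c^T) 0 0.

Let evD c v w : ev c (v + w) = ev c v + ev c w.
Proof. by rewrite /ev mulmxDl mxE. Qed.

Let evZ c x v : ev c (x *: v) = x * ev c v.
Proof. by rewrite /ev -scalemxAl mxE. Qed.

Let evE c v : (v \in zeros c) = (ev c v == 0).
Proof.
rewrite mem_zeros; apply/eqP/eqP => [e|e]; first by rewrite /ev e mxE.
by apply/matrixP => i j; rewrite !ord1 [RHS]mxE.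
Qed.

(* In the chart where P is the vertical direction, L i is x = x_i and M j is
   y = s_j x + t_j; concurrency with L i is equality of values at x_i. *)
Lemma pencil_labelling : exists g h : 'I_n.+1 -> 'I_n.+1,
  [/\ injective g, injective h &
   forall i j, i != j -> exists Q,
     [/\ lies_on Q (M (g i)), lies_on Q (M (g j)) & lies_on Q (L (h (i + j)))]].
Proof.
have [w1 w1L] := line_avoid b0.
(* A vector normal to the span of [p] and [w1] lies outside it, since over the reals it is not
   orthogonal to itself. *)
have [w2 w2N] : exists w2, w2 \notin (<[p]> + <[w1]>)%VS.
  have [|c c0 cU] := @normal_vector _ (<[p]> + <[w1]>)%VS.
    apply: leq_trans (dimv_add_leqif _ _).1 _.
    by rewrite !dim_vline; case: (_ != _); case: (_ != _).
  exists c; apply/negP => /(subvP cU); rewrite evE /ev mxE => /eqP e.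
  case/eqP: c0; apply/rowP => j; rewrite mxE; apply/eqP; rewrite -sqrf_eq0.
  have : forall j, true -> c 0 j * c^T j 0 = 0.
    apply/psumr_eq0P => [i _|//]; rewrite mxE -expr2; exact: sqr_ge0.
  by move=> /(_ j isT); rewrite mxE -expr2 => ->.
have bw1 i : ev (b i) w1 != 0 by rewrite -evE w1L.
have ap i : ev (a i) p != 0.
  by have := PM i; rewrite lies_on_point_of /= evE.
have bp i : ev (b i) p = 0.
  by have := PL i; rewrite lies_on_point_of /= evE => /eqP.
(* These come from solving the equations of L_i and M_i at the point c w1 + w2 + y p for [c] and for
   [y]. *)
pose x i := - ev (b i) w2 / ev (b i) w1.
pose s i := - ev (a i) w1 / ev (a i) p.
pose t i := - ev (a i) w2 / ev (a i) p.
pose v c y := c *: w1 + w2 + y *: p.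
have v0 c y : v c y != 0.
  apply: contraNneq w2N => e.
  have -> : w2 = (- y) *: p + (- c) *: w1.
    rewrite !scaleNr -opprD; apply/eqP; rewrite -addr_eq0 addrC -addrA.
    by rewrite -/(v c y) addrA [y *: p + _]addrC addrAC -/(v c y) e.
  by rewrite memv_add // memvZ // memv_line.
pose pt c y := point_of (v0 c y).
have ptM c y k : lies_on (pt c y) (M k) = (y == s k * c + t k).
  rewrite lies_on_point_of /= evE !evD !evZ -[y == _]subr_eq0.
  have -> : c * ev (a k) w1 + ev (a k) w2 + y * ev (a k) p =
      (y - (s k * c + t k)) * ev (a k) p by rewrite /s /t; field.
  by rewrite mulf_eq0 (negPf (ap k)) orbF.
have ptL c y i : lies_on (pt c y) (L i) = (c == x i).
  rewrite lies_on_point_of /= evE !evD !evZ bp mulr0 addr0 -[c == _]subr_eq0.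
  have -> : c * ev (b i) w1 + ev (b i) w2 = (c - x i) * ev (b i) w1.
    by rewrite /x; field.
  by rewrite mulf_eq0 (negPf (bw1 i)) orbF.
have ptP c y : P != pt c y.
  apply/eqP => /(congr1 val) /= e; move: w2N; apply/negP/negPn.
  have : v c y \in <[p]>%VS by rewrite e memv_line.
  case/vlineP => d vE.
  have -> : w2 = (d - y) *: p + (- c) *: w1.
    rewrite scalerBl -vE /v scaleNr [c *: w1 + w2]addrC addrK.
    by rewrite addrK.
  by rewrite memv_add // memvZ // memv_line.
have x_inj : injective x.
  move=> i j e; apply/L_inj/(line_unique (ptP (x i) 0)) => //.
    by rewrite ptL.
  by rewrite ptL e.
have onM Q i j : lies_on Q (M i) -> lies_on Q (L j) ->
    Q = pt (x j) (s i * x j + t i).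
  move=> Qi Qj; apply/eqP/negPn/negP => ne.
  have h1 : lies_on (pt (x j) (s i * x j + t i)) (L j) by rewrite ptL.
  have h2 : lies_on (pt (x j) (s i * x j + t i)) (M i) by rewrite ptM.
  have LM : L j = M i := line_unique ne Qj h1 Qi h2.
  by move: (PM i); rewrite -LM PL.
have cross i j : i != j -> exists k, s i * x k + t i = s j * x k + t j.
  move=> /MM[k [Q [Qi Qj Qk]]]; exists k; apply/eqP.
  by rewrite -ptM -(onM _ _ _ Qi Qk).
(* Two M's of equal slope still meet over some x_k, so they have equal intercepts and coincide. *)
have s_inj : injective s.
  move=> i j e; apply/eqP/negPn/negP => ij.
  have [k ek] := cross _ _ ij.
  have te : t i = t j by move: ek; rewrite e => /addrI.
  have on c : lies_on (pt c (s i * c + t i)) (M i) /\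
              lies_on (pt c (s i * c + t i)) (M j) by rewrite !ptM e te.
  have ne : pt (x ord0) (s i * x ord0 + t i) != pt (x ord_max) (s i * x ord_max + t i).
    apply/eqP => E; have : lies_on (pt (x ord0) (s i * x ord0 + t i)) (L ord_max).
      by rewrite E ptL.
    rewrite ptL => /eqP/x_inj/(congr1 val) /= n0.
    by move: n1; rewrite -n0.
  case/eqP: ij; apply/M_inj/(line_unique ne);
    [exact: (on _).1|exact: (on _).1|exact: (on _).2|exact: (on _).2].
have gen i j k l : i != j -> j != k -> i != k ->
    s i * x l + t i = s j * x l + t j -> s i * x l + t i = s k * x l + t k -> False.
  move=> ij jk ik e1 e2.
  by apply: (MMM (Q := pt (x l) (s i * x l + t i)) ij jk ik); rewrite ptM ?e1 // -e2 e1.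
have [g [h [g_inj h_inj gh]]] := slopes_labelling (n1 : (2 < n.+1)%N) x_inj s_inj
  cross gen.
exists g, h; split=> // i j ij.
have e := gh i j (i + j) ij (erefl _).
exists (pt (x (h (i + j))) (s (g i) * x (h (i + j)) + t (g i))).
by split; [rewrite ptM eqxx | rewrite ptM e eqxx | rewrite ptL eqxx].
Qed.

End LineCoordinates.

(** * Double points and modular points *)

Lemma card_fset_set_image (T : choiceType) (U : finType) (S : set T) (E : {set U})
    (f : U -> T) : {in E &, injective f} ->
  (forall Q, S Q <-> exists2 p, p \in E & Q = f p) -> #|` fset_set S| = #|E|.
Proof.
move=> f_inj SE.
have -> : S = [set` [fset f p | p in E]%fset]%classic.
  apply/seteqP; split=> Q /=.
    by move/SE => [p pE ->]; rewrite in_imfset.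
  by case/imfsetP => p /= pE ->; apply/SE; exists p.
by rewrite set_fsetK card_in_imfset //= -cardE.
Qed.

Section PencilCount.
Variables (T : choiceType) (n : nat) (onM onL : T -> 'I_n.+1 -> bool) (P : T).
Variable pt : 'I_n.+1 -> 'I_n.+1 -> T.
Hypothesis n1 : (1 < n)%N.
Hypothesis onLP : forall i, onL P i.
Hypothesis onMP : forall j, ~~ onM P j.
Hypothesis onLL : forall Q i k, i != k -> onL Q i -> onL Q k -> Q = P.
Hypothesis onMM : forall Q Q' j k, j != k ->
  onM Q j -> onM Q k -> onM Q' j -> onM Q' k -> Q = Q'.
Hypothesis ptM : forall i j, onM (pt i j) j.
Hypothesis ptL : forall i j, onL (pt i j) i.
Hypothesis ptE : forall Q i j, onM Q j -> onL Q i -> Q = pt i j.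
Hypothesis meet : forall j k, j != k -> exists i Q, [/\ onM Q j, onM Q k & onL Q i].

Let offP Q j : onM Q j -> Q = P -> False.
Proof. by move=> h e; move: (onMP j); rewrite -e h. Qed.

Let onL_uniq Q i k j : onM Q j -> onL Q i -> onL Q k -> i = k.
Proof.
move=> Qj Qi Qk; apply/eqP/negPn/negP => ik.
exact: (offP Qj (onLL ik Qi Qk)).
Qed.

(** The indices [i] for which no other M passes through the point of M_j on L_i. *)
Let simple j := [set i | [forall k, (k != j) ==> ~~ onM (pt i j) k]].
Let E : {set 'I_n.+1 * 'I_n.+1} := [set p | p.2 \in simple p.1].

Let dirs : exists dir : 'I_n.+1 -> 'I_n.+1 -> 'I_n.+1, forall j k i, j != k ->
  onM (pt i j) k = (i == dir j k).
Proof.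
have /fin_all_exists[f fP] : forall jk : 'I_n.+1 * 'I_n.+1, exists i, jk.1 != jk.2 ->
    onM (pt i jk.1) jk.2.
  move=> [j k] /=; have [->|jk] := eqVneq j k; first by exists ord0.
  have [i [Q [Qj Qk Qi]]] := meet jk; exists i => _.
  by rewrite -(ptE Qj Qi).
exists (fun j k => f (j, k)) => j k i jk; apply/idP/eqP => [h|->]; last exact: fP.
have h2 := fP (j, k) jk; rewrite /= in h2.
apply: (onL_uniq (ptM i j) (ptL i j)).
by rewrite (onMM jk (ptM i j) h (ptM _ _) h2).
Qed.

(** Let [dir j k] be the index of the L through the meeting point of M_j and M_k. Then [simple j]
    has one element plus one for each value that [dir j] loses by repetition, so the total is [n.+1]
    exactly when every [dir j] is injective off [j], that is, when no three M's meet. *)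
Lemma card_simple_points : #|E| = n.+1 <->
  (forall Q j k l, j != k -> k != l -> j != l -> onM Q j -> onM Q k -> onM Q l -> False).
Proof.
have [dir dirE] := dirs.
have sE j : simple j = ~: (dir j @: [set~ j]).
  apply/setP => i; rewrite !inE; apply/forallP/idP => [h|].
    apply/negP => /imsetP[k]; rewrite !inE => kj ie.
    by have := h k; rewrite kj dirE 1?eq_sym // ie eqxx.
  move=> h k; apply/implyP => kj; apply: contra h.
  have jk : j != k by rewrite eq_sym.
  rewrite dirE // => /eqP ->.
  by rewrite imset_f // !inE.
have cD j : (#|dir j @: [set~ j]| <= n)%N.
  by rewrite (leq_trans (leq_imset_card _ _)) // cardsC1 card_ord.
have cS j : #|simple j| = (1 + (n - #|dir j @: [set~ j]|))%N.
  have := cardsC (dir j @: [set~ j]); rewrite -sE card_ord.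
  by have := cD j; lia.
have EE : #|E| = (\sum_j #|simple j|)%N.
  under eq_bigr => j _ do rewrite -sum1_card.
  by rewrite pair_big_dep /= -sum1_card; apply: eq_bigl => p; rewrite inE.
rewrite EE (eq_bigr _ (fun j _ => cS j)) big_split /= sum1_card card_ord.
have -> : (n.+1 + \sum_j (n - #|dir j @: [set~ j]|) = n.+1)%N <->
    (forall j, #|dir j @: [set~ j]| = n).
  split=> [/eqP|h]; last by rewrite big1 ?addn0 // => j _; rewrite h subnn.
  rewrite -[X in _ == X]addn0 eqn_add2l sum_nat_eq0 => /forallP h j.
  by apply/eqP; rewrite eqn_leq cD -subn_eq0; have := h j.
have inj_iff j : #|dir j @: [set~ j]| = n <-> {in [set~ j] &, injective (dir j)}.
  have cj : #|[set~ j]| = n by rewrite cardsC1 card_ord.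
  split=> [e|/imset_injP/eqP ->//].
  by apply/imset_injP; rewrite e cj.
split=> h.
  move=> Q j k l jk kl jl Qj Qk Ql; case/eqP: kl.
  apply: ((inj_iff j).1 (h j)); rewrite ?inE 1?eq_sym //.
  have hk : onM (pt (dir j k) j) k by rewrite dirE.
  by apply/eqP; rewrite -dirE // -(onMM jk Qj Qk (ptM _ _) hk).
move=> j; apply/inj_iff => k l; rewrite !inE => kj lj e.
apply/eqP/negPn/negP => kl.
apply: (h (pt (dir j k) j) j k l) => //; rewrite 1?eq_sym //.
  by rewrite dirE // eq_sym.
by rewrite dirE ?e // eq_sym.
Qed.

(** A double point lies on one M and one L: two M's would bring an L with them, and two L's meet
    only at [P], which lies on [n.+1 > 2] of them. *)
Lemma card_double_points (S : set T) :
  (forall Q, S Q <-> (#|[set i | onL Q i]| + #|[set j | onM Q j]| = 2)%N) ->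
  #|` fset_set S| = #|E|.
Proof.
move=> SE; apply: (card_fset_set_image (f := fun p => pt p.2 p.1)).
  move=> [j i] [j' i']; rewrite !inE /= => /forallP h _ e.
  have jj : j' = j.
    by apply/eqP/negPn/negP => ne; have := h j'; rewrite ne e ptM.
  rewrite jj; congr (_, _); rewrite jj in e.
  by apply: (onL_uniq (ptM i j)) => //; rewrite e.
move=> Q; rewrite SE; split=> [c2|[[j i]]]; last first.
  rewrite inE /= inE => /forallP h ->.
  have -> : [set k | onL (pt i j) k] = [set i].
    apply/setP => k; rewrite !inE; apply/idP/eqP => [h2|->]; last exact: ptL.
    exact: (onL_uniq (ptM i j)).
  have -> : [set k | onM (pt i j) k] = [set j].
    apply/setP => k; rewrite !inE; apply/idP/eqP => [h2|->]; last exact: ptM.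
    by apply/eqP/negPn/negP => ne; have := h k; rewrite ne h2.
  by rewrite !cards1.
have [j Qj] : exists j, onM Q j.
  case: (posnP #|[set j | onM Q j]|) => [c0|/card_gt0P[j]]; last first.
    by rewrite inE => Qj; exists j.
  exfalso; move: c2; rewrite c0 addn0 => c2.
  have /card_gt1P[i [k [+ + ik]]] : (1 < #|[set i | onL Q i]|)%N by rewrite c2.
  rewrite !inE => Qi Qk; have e := onLL ik Qi Qk.
  move: c2; rewrite e; have -> : [set i | onL P i] = setT.
    by apply/setP => u; rewrite !inE onLP.
  by rewrite cardsT card_ord; lia.
have cL : (#|[set i | onL Q i]| <= 1)%N.
  rewrite leqNgt; apply/negP => /card_gt1P[i [k [+ + ik]]]; rewrite !inE => Qi Qk.
  exact: (offP Qj (onLL ik Qi Qk)).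
have [i Qi] : exists i, onL Q i.
  have [k Qk] : exists k, (k != j) && onM Q k \/ onL Q k.
    case: (posnP #|[set i | onL Q i]|) => [c0|/card_gt0P[i]]; last first.
      by rewrite inE => Qi; exists i; right.
    have /card_gt1P[u [v [+ + uv]]] : (1 < #|[set i | onM Q i]|)%N.
      by move: c2; rewrite c0 add0n => ->.
    rewrite !inE => Qu Qv; have [uj|uj] := eqVneq u j.
      by exists v; left; rewrite Qv -uj eq_sym uv.
    by exists u; left; rewrite uj Qu.
  case: Qk => [/andP[kj Qk]|]; last by exists k.
  have jk : j != k by rewrite eq_sym.
  have [i [Q' [h1 h2 h3]]] := meet jk; exists i.
  by rewrite (onMM jk Qj Qk h1 h2).
exists (j, i); last exact: ptE.
rewrite inE /= inE; apply/forallP => k; apply/implyP => kj; rewrite -(ptE Qj Qi).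
apply/negP => Qk; have : (1 < #|[set j | onM Q j]|)%N.
  by apply/card_gt1P; exists j, k; rewrite !inE Qj Qk eq_sym.
have : (0 < #|[set i | onL Q i]|)%N by apply/card_gt0P; exists i; rewrite inE.
by move: c2; clear; lia.
Qed.

End PencilCount.

Lemma card_fset_sep (T : choiceType) (A : {fset T}) (p : pred T) :
  #|` [fset x in A | p x]%fset| = #|[set x : A | p (val x)]|.
Proof.
have -> : [fset x in A | p x]%fset = [fset val x | x in [set x : A | p (val x)]]%fset.
  apply/fsetP => x; rewrite finmap.inE /=; apply/andP/imfsetP => [[xA px]|[y /=]].
    by exists (FSetSub xA); rewrite ?in_set.
  by rewrite in_set => py ->; split=> //; apply: valP.
by rewrite card_imfset ?cardE //; apply: val_inj.
Qed.

Lemma card_setP (T : finType) (S : {set T}) (k : nat) : #|S| = k ->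
  exists2 f : 'I_k -> T, injective f & forall x, x \in S <-> exists i, x = f i.
Proof.
move=> <-; exists enum_val => [|x]; first exact: enum_val_inj.
split=> [xS|[i ->]]; last exact: enum_valP.
by exists (enum_rank_in xS x); rewrite enum_rankK_in.
Qed.

Lemma card_two_families (T U : finType) (f g : U -> T) (p : pred T) :
  injective f -> injective g -> (forall i j, f i != g j) ->
  (forall x, (exists i, x = f i) \/ (exists i, x = g i)) ->
  #|[set x | p x]| = (#|[set i | p (g i)]| + #|[set i | p (f i)]|)%N.
Proof.
move=> f_inj g_inj fg cov.
rewrite -(card_imset [set i | p (f i)] f_inj) -(card_imset [set i | p (g i)] g_inj).
rewrite -cardsUI.
have -> : g @: [set i | p (g i)] :&: f @: [set i | p (f i)] = set0.
  apply/setP => x; rewrite !inE; apply/negP => /andP[/imsetP[i _ ->] /imsetP[j _ /eqP]].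
  by rewrite eq_sym (negPf (fg _ _)).
rewrite cards0 addn0; apply: eq_card => x; rewrite !inE.
apply/idP/orP => [px|[]/imsetP[i]]; last 2 first.
- by rewrite inE => pi ->.
- by rewrite inE => pi ->.
by case: (cov x) px => [] [i ->] px; [right|left]; rewrite imset_f // inE.
Qed.

Section ModularPoint.
Variables (F : fieldType) (A : {fset pline F}).
Implicit Types (P Q Y : ppoint F) (X N Z : A).

Definition through Q : {set A} := [set x : A | lies_on Q (val x)].

Lemma throughE Q X : (X \in through Q) = lies_on Q (val X).
Proof. by rewrite in_set. Qed.

Lemma multiplicityE Q : multiplicity A Q = #|through Q|.
Proof. exact: card_fset_sep. Qed.

Lemma meet_Sing X N Y : X != N -> lies_on Y (val X) -> lies_on Y (val N) -> Sing A Y.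
Proof.
move=> XN YX YN; rewrite /Sing /mkset multiplicityE.
by apply/card_gt1P; exists X, N; split=> //; rewrite throughE.
Qed.

Lemma modular_line P X N Y : modular A P -> X != N ->
  lies_on Y (val X) -> lies_on Y (val N) -> Y != P ->
  exists Z, lies_on P (val Z) /\ lies_on Y (val Z).
Proof.
move=> [_ modP] XN YX YN /eqP YP.
have [L LA LE] := modP Y (meet_Sing XN YX YN) YP.
exists (FSetSub LA); rewrite /lies_on /=.
by split; rewrite LE ?addvSl ?addvSr.
Qed.

(* A line N missing P and Q would map the pencil at Q injectively to the pencil
   at P, through the points of N. *)
Lemma modular_pencil_le P Q N : modular A P ->
  ~~ lies_on P (val N) -> ~~ lies_on Q (val N) -> (#|through Q| <= #|through P|)%N.
Proof.
move=> modP NP NQ.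
have /fin_all_exists[h hP] : forall X : A, exists Z : A, X \in through Q ->
    Z \in through P /\
    exists Y, [/\ lies_on Y (val X), lies_on Y (val N) & lies_on Y (val Z)].
  move=> X; have [XQ|XQ] := boolP (X \in through Q); last by exists X.
  have [Y YX YN] := meet_point (val X) (val N).
  have XN : X != N.
    by apply: contraNneq NQ => <-; rewrite -throughE.
  have YP : Y != P by apply: contraNneq NP => <-.
  have [Z [ZP ZY]] := modular_line modP XN YX YN YP.
  by exists Z => _; rewrite throughE; split=> //; exists Y.
have h_inj : {in through Q &, injective h}.
  move=> X X' XQ XQ' e; have [ZP [Y [YX YN YZ]]] := hP _ XQ.
  have [_ [Y' [YX' YN' YZ']]] := hP _ XQ'; rewrite -e in YZ'.
  have YY : Y = Y'.
    apply/eqP/negPn/negP => ne; have ZN := line_unique ne YZ YZ' YN YN'.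
    by move: NP; rewrite -ZN -throughE ZP.
  have QY : Q != Y by apply: contraNneq NQ => ->.
  move: XQ XQ'; rewrite !throughE => XQ XQ'; rewrite -YY in YX'.
  exact/val_inj/(line_unique QY).
rewrite -(card_in_imset h_inj); apply/subset_leq_card/subsetP => Z /imsetP[X XQ ->].
by have [] := hP _ XQ.
Qed.

(** The [maxn 1] covers the points outside [Sing A], on at most one line. *)
Lemma Sing_multiplicity_le Q : (multiplicity A Q <= maxn 1 (max_multiplicity A))%N.
Proof.
have [/= m1|m2] := leqP (multiplicity A Q) 1; first by rewrite leq_max m1.
rewrite leq_max; apply/orP; right.
apply: (@leq_bigmax_seq _ _ xpredT (multiplicity A) Q) => //.
by rewrite in_fset_set; [apply/mem_set | apply: finite_Sing].
Qed.

(** Let [Q] have multiplicity at least [m]. If [P] had less, no line could miss both points, and the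
    two pencils together would have fewer than [2 * m] lines. *)
Lemma modular_multiplicity P (m : nat) : (0 < m)%N ->
  modular A P -> max_multiplicity A = m -> #|` A| = (2 * m)%N ->
  multiplicity A P = m.
Proof.
move=> m0 modP mA cardA.
have [Q Qm] : exists Q, (m <= multiplicity A Q)%N.
  apply: contrapT => no; have : (max_multiplicity A <= m.-1)%N.
    apply/bigmax_leqP_seq => Q _ _; rewrite -ltnS prednK // ltnNge.
    by apply/negP => h; apply: no; exists Q.
  by rewrite mA; move: m0; clear; lia.
have le_m Y : (multiplicity A Y <= m)%N.
  by have := Sing_multiplicity_le Y; rewrite mA; move: m0; clear; lia.
apply/eqP; rewrite eqn_leq le_m leqNgt; apply/negP => Pm.
have cov : through P :|: through Q = setT.
  apply/setP => N; rewrite in_setU in_setT !throughE.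
  apply: contraTT Pm; rewrite negb_or -leqNgt => /andP[NP NQ].
  rewrite (leq_trans Qm) // !multiplicityE.
  exact: modular_pencil_le modP NP NQ.
have := (leq_card_setU (through P) (through Q)).1; rewrite cov cardsT -cardfE cardA.
by rewrite -!multiplicityE; have := le_m Q; move: Pm; clear; lia.
Qed.

End ModularPoint.

Section PencilFamilies.
Variables (F : fieldType) (A : {fset pline F}) (n : nat) (P : ppoint F).
Hypothesis n1 : (1 < n)%N.
Hypothesis modP : modular A P.
Hypothesis mA : max_multiplicity A = n.+1.
Hypothesis cardA : #|` A| = (2 * n.+1)%N.

Definition pencil_families (M L : 'I_n.+1 -> A) : Prop :=
  [/\ injective M, injective L,
      forall x, (exists i, x = M i) \/ (exists i, x = L i),
      forall i, lies_on P (val (L i)) & forall i, ~~ lies_on P (val (M i))].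

Lemma pencil_families_exist : exists M L, pencil_families M L.
Proof.
have cP : #|through A P| = n.+1.
  by rewrite -multiplicityE (modular_multiplicity (ltn0Sn n) modP mA cardA).
have cC : #|~: through A P| = n.+1.
  have := cardsC (through A P); rewrite cP -cardfE cardA; clear; lia.
have [L L_inj LP] := card_setP cP; have [M M_inj MP] := card_setP cC.
exists M, L; split=> // [x|i|i].
- have [xP|xP] := boolP (x \in through A P); first by right; apply/LP.
  by left; apply/MP; rewrite in_setC.
- by rewrite -throughE; apply/LP; exists i.
- by rewrite -throughE -in_setC; apply/MP; exists i.
Qed.

Variables M L : 'I_n.+1 -> A.
Hypothesis ML : pencil_families M L.

Lemma pencil_families_neq i j : M i != L j.
Proof.
have [_ _ _ PL PM] := ML.
by apply: contraNneq (PM i) => ->; apply: PL.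
Qed.

Lemma pencil_families_meet i j : i != j -> exists k Q,
  [/\ lies_on Q (val (M i)), lies_on Q (val (M j)) & lies_on Q (val (L k))].
Proof.
have [M_inj L_inj cov PL PM] := ML; move=> ij.
have Mij : M i != M j by rewrite (inj_eq M_inj).
have [Q Qi Qj] := meet_point (val (M i)) (val (M j)).
have QP : Q != P by apply: contraNneq (PM i) => <-.
have [Z [ZP ZQ]] := modular_line modP Mij Qi Qj QP.
case: (cov Z) => [] [k kE]; last by exists k, Q; rewrite -kE.
by move: (PM k); rewrite -kE ZP.
Qed.

Lemma Sing2_card_iff : #|` fset_set (Sing2 A)| = n.+1 <->
  (forall Q i j k, i != j -> j != k -> i != k -> lies_on Q (val (M i)) ->
     lies_on Q (val (M j)) -> lies_on Q (val (M k)) -> False).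
Proof.
have [M_inj L_inj cov PL PM] := ML.
have /fin_all_exists[f fP] : forall ij : 'I_n.+1 * 'I_n.+1, exists Q,
    lies_on Q (val (M ij.2)) /\ lies_on Q (val (L ij.1)).
  move=> ij; have [Q h1 h2] := meet_point (val (M ij.2)) (val (L ij.1)).
  by exists Q.
pose pt i j := f (i, j).
have LL Q i k : i != k -> lies_on Q (val (L i)) -> lies_on Q (val (L k)) -> Q = P.
  move=> ik Qi Qk; apply/eqP/negPn/negP => QP; case/eqP: ik.
  exact/L_inj/val_inj/(line_unique QP Qi (PL i) Qk (PL k)).
have MM Q Q' j k : j != k -> lies_on Q (val (M j)) -> lies_on Q (val (M k)) ->
    lies_on Q' (val (M j)) -> lies_on Q' (val (M k)) -> Q = Q'.
  move=> jk h1 h2 h3 h4; apply/eqP/negPn/negP => QP; case/eqP: jk.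
  exact/M_inj/val_inj/(line_unique QP h1 h3 h2 h4).
have ptM i j : lies_on (pt i j) (val (M j)) by case: (fP (i, j)).
have ptL i j : lies_on (pt i j) (val (L i)) by case: (fP (i, j)).
have ptE Q i j : lies_on Q (val (M j)) -> lies_on Q (val (L i)) -> Q = pt i j.
  move=> h1 h2; apply/eqP/negPn/negP => QP.
  have := pencil_families_neq j i; apply/negP/negPn/eqP.
  exact/val_inj/(line_unique QP h1 (ptM i j) h2 (ptL i j)).
pose onM (Q : ppoint F) j := lies_on Q (val (M j)).
pose onL (Q : ppoint F) j := lies_on Q (val (L j)).
rewrite (card_double_points (onM := onM) (onL := onL) n1 PL PM LL MM ptM ptL ptE
  pencil_families_meet).
  exact: (card_simple_points (onM := onM) (onL := onL) n1 PM LL MM ptM ptL ptE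
  pencil_families_meet).
move=> Q.
have <- : multiplicity A Q = (#|[set i | onL Q i]| + #|[set j | onM Q j]|)%N.
  rewrite multiplicityE.
  exact: (card_two_families (fun x : A => lies_on Q (val x)) M_inj L_inj
    pencil_families_neq cov).
rewrite /Sing2 /Sing /mkset; split=> [[]//|e].
by split=> //; rewrite e.
Qed.

End PencilFamilies.

(** * Isotropic triples of pencils, and the equivalence *)

Lemma ext_coef_baseB (K : fieldType) (I : finType) (c d i : I) :
  ext_coef (ext_base K [set c] - ext_base K [set d]) i = (i == c)%:R - (i == d)%:R.
Proof. by rewrite /ext_coef !ffunE !(inj_eq set1_inj). Qed.

Lemma ext_homog_baseB (K : fieldType) (I : finType) (c d : I) :
  ext_homog 1 (ext_base K [set c] - ext_base K [set d]).
Proof.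
move=> S S1; rewrite !ffunE; case: (eqVneq S [set c]) S1 => [->|_ S1].
  by rewrite cards1.
by case: (eqVneq S [set d]) S1 => [->|_ _]; rewrite ?cards1 // subr0.
Qed.

Lemma pencil_triple (K : fieldType) (I : finType) (dep : pred {set I})
    (T : {set I}) (c : I) (q : 'I_3 -> I) :
  (forall i j k, i \in T -> j \in T -> k \in T -> i != j -> i != k -> j != k ->
     dep [set i; j; k]) ->
  c \in T -> (forall a, q a \in T) -> injective q -> (forall a, q a != c) ->
  isotropic_triple dep (fun a => ext_base K [set c] - ext_base K [set q a]).
Proof.
move=> depT cT qT q_inj qc.
have coefE a := ext_coef_baseB K c (q a).
have homog a := ext_homog_baseB K c (q a).
have out a i : i \notin T -> (i == c)%:R - (i == q a)%:R = 0 :> K.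
  move=> iT; case: (eqVneq i c) iT => [->|_ iT]; first by rewrite cT.
  by case: (eqVneq i (q a)) iT => [->|_ _]; rewrite ?qT // subr0.
have sum0 a : \sum_i ext_coef (ext_base K [set c] - ext_base K [set q a]) i = 0.
  have s1 (j : I) : \sum_i (i == j)%:R = 1 :> K.
    rewrite (bigD1 j) //= big1 ?eqxx ?addr0 // => i /negPf ->.
    by [].
  by under eq_bigr => i _ do rewrite coefE; rewrite sumrB !s1 subrr.
split=> // [a b ab|d d0 a].
  by apply: (gen_ideal_pencil depT) => // i iT; rewrite coefE out.
have := congr1 (fun x : ext K I => ext_coef x (q a)) d0.
rewrite /ext_coef sum_ffunE (bigD1 a) //= big1 => [|b ba]; rewrite !ffunE.
  rewrite !(inj_eq set1_inj) (negPf (qc a)) eqxx sub0r addr0 scalerN => /eqP.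
  by rewrite oppr_eq0 /GRing.scale /= mulr1 => /eqP.
rewrite !(inj_eq set1_inj) (negPf (qc a)) (inj_eq q_inj) eq_sym (negPf ba).
by rewrite subr0 scaler0.
Qed.

(** Apply the local criterion on [T] at the element [e]: the first factor has sum 1 over [T] and
    coefficient 0 at [e], while the second has coefficient 1 at [e]. *)
Lemma baseB_mul_notin (K : fieldType) (I : finType) (dep : pred {set I})
    (T : {set I}) (c d e f : I) :
  (forall S, dep S -> (2 < #|S|)%N) ->
  (forall i j k, i \in T -> j \in T -> i != j -> dep [set i; j; k] -> k \in T) ->
  c \in T -> d \notin T -> e \in T -> e != c -> f != e ->
  (ext_base K [set c] - ext_base K [set d]) * (ext_base K [set e] - ext_base K [set f])
    \notin gen_ideal K dep.
Proof.
move=> dep_gt2 flatT cT dT eT ec fe; apply/negP => xy.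
have ed : e != d by apply: contraNneq dT => <-.
have := gen_ideal_local dep_gt2 flatT (ext_homog_baseB K c d) (ext_homog_baseB K e f)
  xy eT.
rewrite !ext_coef_baseB (negPf ec) (negPf ed) [e == f]eq_sym (negPf fe) eqxx.
rewrite !subr0 mulr0 mulr1 => /eqP; apply/negP.
under eq_bigr => i _ do rewrite ext_coef_baseB.
rewrite (bigD1 c) //= big1 ?addr0 => [|i /andP[iT ic]].
  rewrite eqxx; case: (eqVneq c d) cT dT => [->->//|_ _ _].
  by rewrite subr0 oner_neq0.
rewrite (negPf ic); case: (eqVneq i d) iT => [->|_ _]; last by rewrite subr0.
by rewrite (negPf dT).
Qed.

Lemma card_gt3 (T : finType) (S : {set T}) (c : T) (q : 'I_3 -> T) :
  injective q -> (forall a, q a != c) -> c \in S -> (forall a, q a \in S) ->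
  (3 < #|S|)%N.
Proof.
move=> q_inj qc cS qS.
have cU : #|c |: [set q a | a in predT]| = 4%N.
  rewrite cardsU1 card_imset // card_ord.
  case: imsetP => // -[a _ e].
  by move: (qc a); rewrite e eqxx.
rewrite -cU; apply/subset_leq_card/subsetP => x.
by rewrite !inE => /orP[/eqP ->//|/imsetP[a _ ->]].
Qed.

Lemma three_points (T : eqType) (b0 b1 b2 : T) : b0 != b1 -> b0 != b2 -> b1 != b2 ->
  exists q : 'I_3 -> T, [/\ injective q, q ord0 = b0 &
    forall p : T -> Prop, p b0 -> p b1 -> p b2 -> forall a, p (q a)].
Proof.
move=> b01 b02 b12.
have u : uniq [:: b0; b1; b2] by rewrite /= !inE negb_or b01 b02 b12.
exists (tnth [tuple b0; b1; b2]); split=> //.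
  by apply/injectiveP; rewrite /injectiveb /dinjectiveb map_tnth_enum.
by move=> p p0 p1 p2 [[|[|[|]]] h].
Qed.

Section PencilResonance.
Variables (K F : fieldType) (A B : {fset pline F}) (n : nat) (P : ppoint F).

Lemma pencil_dependent (Q : ppoint F) (X Y Z : A) :
  X \in through A Q -> Y \in through A Q -> Z \in through A Q ->
  X != Y -> X != Z -> Y != Z -> os_dependent [set X; Y; Z].
Proof.
rewrite !throughE => XQ YQ ZQ XY XZ YZ.
apply/(os_dependent3 (cards3 XY XZ YZ)); exists Q.
exact/in_set3P.
Qed.

Lemma pencil_flat (Q : ppoint F) (X Y Z : A) :
  X \in through A Q -> Y \in through A Q -> X != Y ->
  os_dependent [set X; Y; Z] -> Z \in through A Q.
Proof.
move=> XQ YQ XY dep.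
have [<- //|XZ] := eqVneq X Z; have [<- //|YZ] := eqVneq Y Z.
move/(os_dependent3 (cards3 XY XZ YZ)): dep => [Q' /in_set3P[h1 h2 h3]].
move: XQ YQ; rewrite !throughE => XQ YQ.
have [-> //|QQ'] := eqVneq Q Q'; case/eqP: XY.
exact/val_inj/(line_unique QQ' XQ h1 YQ h2).
Qed.

(** Three M's through [Q] bring an L with them, so the pencils at [Q] and at [P] both carry
    isotropic triples. All products between the two triples would vanish, but one of them does
    not. *)
Lemma equivalent_no_triple (M L : 'I_n.+1 -> A) (M' L' : 'I_n.+1 -> B) :
  [pchar K] =i pred0 -> (1 < n)%N -> modular A P -> max_multiplicity A = n.+1 ->
  pencil_families P M L -> dihedral (@os_dependent F B) M' L' ->
  combinatorially_equivalent K A B ->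
  forall Q i j k, i != j -> j != k -> i != k -> lies_on Q (val (M i)) ->
     lies_on Q (val (M j)) -> lies_on Q (val (M k)) -> False.
Proof.
move=> charK n1 modP mA ML dih equiv Q i j k ij jk ik Qi Qj Qk.
have [M_inj L_inj cov PL PM] := ML.
have neq := pencil_families_neq ML.
have Mij : M i != M j by rewrite (inj_eq M_inj).
have Mik : M i != M k by rewrite (inj_eq M_inj).
have Mjk : M j != M k by rewrite (inj_eq M_inj).
have [l [Q' [Q'i Q'j Q'l]]] := pencil_families_meet modP ML ij.
have Ql : lies_on Q (val (L l)).
  have [-> //|QQ'] := eqVneq Q Q'; case/eqP: Mij.
  exact/val_inj/(line_unique QQ' Qi Q'i Qj Q'j).
have [q [q_inj q0 qP]] := three_points Mjk (neq j l) (neq k l).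
have Mji : M j != M i by rewrite (inj_eq M_inj) eq_sym.
have Mki : M k != M i by rewrite (inj_eq M_inj) eq_sym.
have Lli : L l != M i by rewrite eq_sym; exact: neq.
have qi := qP (fun X => X != M i) Mji Mki Lli.
have iQ : M i \in through A Q by rewrite throughE.
have jQ : M j \in through A Q by rewrite throughE.
have kQ : M k \in through A Q by rewrite throughE.
have lQ : L l \in through A Q by rewrite throughE.
have qQ := qP (fun X => X \in through A Q) jQ kQ lQ.
(* The multiplicity of [Q] is at least 4 and at most [n.+1], so the pencil at [P] also has the four
   lines needed for a triple. *)
have n3 : (3 <= n)%N.
  have := card_gt3 q_inj qi iQ qQ; rewrite -multiplicityE.
  by have := Sing_multiplicity_le A Q; rewrite mA; clear; lia.
pose r (a : 'I_3) := L (lift ord0 (widen_ord n3 a)).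
have r_inj : injective r.
  by move=> a b /L_inj/lift_inj/(congr1 val)/= /val_inj.
have r0 a : r a != L ord0 by rewrite (inj_eq L_inj) eq_sym neq_lift.
have LP i' : L i' \in through A P by rewrite throughE.
have tx := pencil_triple K (@pencil_dependent P) (LP ord0) (fun a => LP _) r_inj r0.
have ty := pencil_triple K (@pencil_dependent Q) iQ qQ q_inj qi.
have := resonance_unique_pencil ord0 ord0 charK dih equiv tx ty.
(* At the meeting point of M_i and L_0 the local criterion detects the product of e_(L_0) - e_(r 0)
   and e_(M_i) - e_(q 0), because [r 0] misses this point. *)
have [Y YM YL] := meet_point (val (M i)) (val (L ord0)).
apply/negP; apply: (baseB_mul_notin K (T := through A Y)).
- exact: os_dependent_gt2.
- exact: pencil_flat.
- by rewrite throughE.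
- rewrite throughE; apply/negP => Yr.
  have YP : Y != P by apply: contraNneq (PM i) => <-.
  case/eqP: (r0 ord0).
  exact/val_inj/(line_unique YP Yr (PL _) YL (PL _)).
- by rewrite throughE.
- exact: neq.
- exact: qi.
Qed.

End PencilResonance.

Lemma no_triple_dihedral (R : realType) (A : {fset pline R}) (n : nat) (P : ppoint R)
    (M L : 'I_n.+1 -> A) :
  (1 < n)%N -> modular A P -> pencil_families P M L ->
  (forall Q i j k, i != j -> j != k -> i != k -> lies_on Q (val (M i)) ->
     lies_on Q (val (M j)) -> lies_on Q (val (M k)) -> False) ->
  exists M' L' : 'I_n.+1 -> A, dihedral (@os_dependent R A) M' L'.
Proof.
move=> n1 modP ML no3; have [M_inj L_inj cov PL PM] := ML.
have eqs (f : 'I_n.+1 -> A) : exists a (a0 : forall i, a i != 0),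
    forall i, val (f i) = line_of (a0 i).
  have /fin_all_exists[a aP] : forall i, exists a, exists a0 : a != 0,
      val (f i) = line_of a0 by move=> i; apply: line_equation.
  have a0 i : a i != 0 by case: (aP i).
  exists a, a0 => i; have [b0 ->] := aP i.
  exact: val_inj.
have [a [a0 aE]] := eqs M; have [b [b0 bE]] := eqs L.
have [p [p0 PE]] := point_ofP P.
have M_inj' : injective (fun i => line_of (a0 i)).
  by move=> i j; rewrite -!aE => /val_inj/M_inj.
have L_inj' : injective (fun i => line_of (b0 i)).
  by move=> i j; rewrite -!bE => /val_inj/L_inj.
have PL' i : lies_on (point_of p0) (line_of (b0 i)) by rewrite -bE -PE.
have PM' i : ~~ lies_on (point_of p0) (line_of (a0 i)) by rewrite -aE -PE.
have MM i j : i != j -> exists k Q, [/\ lies_on Q (line_of (a0 i)),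
    lies_on Q (line_of (a0 j)) & lies_on Q (line_of (b0 k))].
  move=> /(pencil_families_meet modP ML)[k [Q h]]; exists k, Q.
  by rewrite -!aE -bE.
have MMM i j k Q : i != j -> j != k -> i != k -> lies_on Q (line_of (a0 i)) ->
    lies_on Q (line_of (a0 j)) -> lies_on Q (line_of (a0 k)) -> False.
  rewrite -!aE; exact: no3.
have [g [h [g_inj h_inj gh]]] :=
  pencil_labelling M_inj' L_inj' PL' PM' n1 MM MMM.
exists (M \o g), (L \o h).
apply: (dihedral_of_incidence (P := P)).
- exact: inj_comp.
- exact: inj_comp.
- move=> x; case: (cov x) => [] [i ->].
    by left; have [g' _ gK] := injF_bij g_inj; exists (g' i); rewrite /comp gK.
  by right; have [h' _ hK] := injF_bij h_inj; exists (h' i); rewrite /comp hK.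
- by move=> i; apply: PL.
- by move=> i; apply: PM.
- by move=> i j /gh[Q]; rewrite -!aE -bE; exists Q.
Qed.

Theorem theorem2p6 (R : realType) (K : fieldType) (charK : [pchar K] =i pred0)
  (m : nat) (hm : (3 <= m)%N) (A : {fset pline R})
  (ssA : supersolvable A) (mA : max_multiplicity A = m)
  (cardA : #|` A| = (2 * m)%N) :
  #|` fset_set (Sing2 A)| = m <->
  combinatorially_equivalent K A (boroczky R m).
Proof.
case: m hm mA cardA => [//|n] hm mA cardA; have n1 : (1 < n)%N := hm.
have [P modP] := ssA.
have [M [L ML]] := pencil_families_exist modP mA cardA.
have dihB := boroczky_dihedral R n.
rewrite (Sing2_card_iff n1 modP ML); split.
  move=> /(no_triple_dihedral n1 modP ML)[M' [L' dihA]].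
  (* The codimension never exceeds 3. *)
  have dep_gt3 (C : {fset pline R}) (S : {set C}) : (3 < #|S|)%N -> os_dependent S.
    by apply: leq_ltn_trans; apply: leq_subr.
  have [phi phi_bij phi_dep] := dihedral_equivalent dihA dihB
    (@os_dependent_gt2 R A) (dep_gt3 A) (@os_dependent_gt2 R _) (dep_gt3 _).
  exact: combinatorially_equivalent_bij phi_bij phi_dep.
exact: equivalent_no_triple charK n1 modP mA ML dihB.
Qed.
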